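(* Let $D_{\mathcal X}=\mathcal N(\mathbf 0,\boldsymbol\Sigma_{D_{\mathcal X}})$ with $\boldsymbol\Sigma_{D_{\mathcal X}}$ positive definite, and let $\mathbf x_1,\dots,\mathbf x_{2d+2}$ be i.i.d. from $D_{\mathcal X}$. Define, for $i=1,\dots,d$, $\widetilde{\mathbf x}_i=\Big(\sum_{j=d+1}^{2d+2}\mathbf x_j\mathbf x_j^\top\Big)^{1/2}\Big(\sum_{j=1}^{d}\mathbf x_j\mathbf x_j^\top\Big)^{-1/2}\mathbf x_i$. Then $(\widetilde{\mathbf x}_1,\dots,\widetilde{\mathbf x}_d)\sim\mathrm{VS}_{D_{\mathcal X}}^d$.
   Context: For a positive definite matrix $\mathbf A$, $\mathbf A^{1/2}$ denotes the unique lower triangular matrix with positive diagonal entries such that $\mathbf A^{1/2}(\mathbf A^{1/2})^\top=\mathbf A$ (Cholesky factor), and $\mathbf A^{-1/2}:=(\mathbf A^{1/2})^{-1}$. $\mathrm{VS}_{D_{\mathcal X}}^d$ is the probability measure on $(\mathbb R^d)^d$ given by $\mathrm{VS}_{D_{\mathcal X}}^d(A)=\mathbb E_{D_{\mathcal X}^d}[\mathbf 1_A\det(\sum_{i=1}^d\mathbf x_i\mathbf x_i^\top)]/\big(d!\det(\boldsymbol\Sigma_{D_{\mathcal X}})\big)$, where $D_{\mathcal X}^d$ is the law of $d$ i.i.d. draws from $D_{\mathcal X}$. *)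

(* Defs.v *)
From HB Require Import structures.
From mathcomp Require Import all_boot all_order all_algebra.
From mathcomp Require Import all_classical all_reals all_analysis.
Set Implicit Arguments. Unset Strict Implicit. Unset Printing Implicit Defensive.
Import Order.TTheory GRing.Theory Num.Theory.
Local Open Scope classical_set_scope.
Local Open Scope ring_scope.

(* A column vector of R^d seen as a d-tuple (the measurable space of
   d-tuples carries the product sigma-algebra). *)
Definition tup_of_cV {R : realType} {d : nat} (v : 'cV[R]_d) : d.-tuple R :=
  [tuple v i 0 | i < d].

Definition posdef {R : realType} {d : nat} (S : 'M[R]_d) : Prop :=
  S^T = S /\ forall x : 'cV[R]_d, x != 0 -> 0 < (x^T *m S *m x) 0 0.

(* Cholesky factor: the lower triangular L with positive diagonal and
   L L^T = A (unique when A is positive definite; 0 if no such L exists). *)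
Definition chol_spec {R : realType} {d : nat} (A L : 'M[R]_d) : Prop :=
  [/\ (forall i j : 'I_d, (i < j)%N -> L i j = 0),
      (forall i : 'I_d, 0 < L i i) & L *m L^T = A].

Definition chol {R : realType} {d : nat} (A : 'M[R]_d) : 'M[R]_d :=
  xget 0 (chol_spec A).

Definition msqrt {R : realType} {d : nat} (A : 'M[R]_d) : 'M[R]_d := chol A.
Definition minvsqrt {R : realType} {d : nat} (A : 'M[R]_d) : 'M[R]_d :=
  invmx (chol A).

Definition is_gaussian0 {R : realType} {d0 : measure_display}
  {Omega : measurableType d0} (P : probability Omega R) {d : nat}
  (S : 'M[R]_d) (X : Omega -> 'cV[R]_d) : Prop :=
  measurable_fun setT (fun w => tup_of_cV (X w)) /\
  forall a : 'cV[R]_d, a != 0 ->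
  forall B : set R, measurable B ->
    P [set w | B ((a^T *m X w) 0 0)] =
    normal_prob 0 (Num.sqrt ((a^T *m S *m a) 0 0)) B.

Definition mutually_independent {R : realType} {d0 : measure_display}
  {Omega : measurableType d0} (P : probability Omega R) {d n : nat}
  (X : 'I_n -> Omega -> 'cV[R]_d) : Prop :=
  forall B : 'I_n -> set (d.-tuple R), (forall k, measurable (B k)) ->
    P (\bigcap_(k in [set: 'I_n]) [set w | B k (tup_of_cV (X k w))]) =
    (\prod_(k < n) P [set w | B k (tup_of_cV (X k w))])%E.

Lemma leq_d_2d2 (d : nat) : (d <= 2 * d + 2)%N.
Proof. by rewrite mul2n -addnn -addnA leq_addr. Qed.

(* the index of x_{i+1} among x_1..x_{2d+2} (0-based) *)
Definition first_block {d : nat} (i : 'I_d) : 'I_(2 * d + 2) :=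
  widen_ord (leq_d_2d2 d) i.

(* Main.v *)
Require Import Defs.
From HB Require Import structures.
From mathcomp Require Import all_boot all_order all_algebra.
From mathcomp Require Import all_classical all_reals all_analysis.
From mathcomp Require Import perm measurable_realfun.
From mathcomp Require Import lra ring.
Set Implicit Arguments. Unset Strict Implicit. Unset Printing Implicit Defensive.
Import Order.TTheory GRing.Theory Num.Theory.
Import numFieldNormedType.Exports.
Local Open Scope classical_set_scope.
Local Open Scope ring_scope.

(** Write [x] for the d x d matrix with columns [x_1, ..., x_d], [S1 = x x^T], and let [S2] be the
    Gram matrix of the last d + 2 vectors.

    First, [E (det S1 * f S1) = d! det Sigma * E (f S2)]: it suffices to compare Laplace transforms.
    Weighting a Gaussian vector by [h x = exp (- sum_k t_k (v_k . x)^2)] gives [Phi] times a Gaussian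
    law of covariance [S] with [det S = det Sigma * Phi^2]. Expanding the determinant,
    [E (det S1 * prod_(j <= d) h x_j) = d! Phi^d det S = d! det Sigma * Phi^(d + 2)], and
    [Phi^(d + 2)] is the Laplace transform of [S2].

    Secondly, the law of [x] is invariant under right multiplication by orthogonal matrices and [x]
    is almost surely invertible, so in [x = chol S1 * Q] the orthogonal factor [Q] is independent of
    [S1] (its law is invariant on the right, hence equal to that of [Q^T], hence invariant on the
    left).

    As [(chol S1)^-1 x_i] is the i-th column of [Q], the vectors of the statement are the columns of
    [chol S2 * Q], with [Q] and [S2] independent; by the two facts their law is that of
    [x = chol S1 * Q] with density [det S1 / (d! det Sigma)]. *)

(** * The sigma-algebra of matrices *)

(** [is_gaussian0] only describes the projections [a^T X]. No multivariate density and no Jacobian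
    appears: every identity of laws comes from a computed transform, and the only densities are
    those of the normal laws on the line. Characteristic functions stay real. Knowing the integral
    of [cos (mxdot A M + c)] for every phase [c] gives both real and imaginary parts, and the phase
    absorbs independent summands that are held fixed. The exponent d + 2 explains the size of the
    second block: d factors [Phi] come from the d weighted columns and two more from the determinant
    of the tilted covariance, whose relation to [Phi] is carried as an invariant through rank-one
    tilts. No Haar measure is constructed; an independent copy of the orthogonal factor does its
    work. Laws are compared by integrating arbitrary nonnegative measurable functions. Tonelli then
    applies without integrability conditions, and the default value of [chol] on the second block
    needs no exceptional set; only singular x has to be discarded as a null event. *)

Section matrix_sigma_algebra.
Context {R : realType} {m n : nat}.

(** Lower orthants form a pi-system, and their probabilities are what the uniqueness theorem for
    Laplace transforms delivers; hence the choice of generators. *)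
Definition mx_box (a : 'M[R]_(m, n)) : set 'M[R]_(m, n) :=
  [set M | forall i j, M i j <= a i j].

Definition mx_boxes : set (set 'M[R]_(m, n)) := range mx_box.

Let mx0 : <<s mx_boxes >> set0. Proof. exact: sigma_algebra0. Qed.
Let mxC A : <<s mx_boxes >> A -> <<s mx_boxes >> (~` A).
Proof. exact: sigma_algebraC. Qed.
Let mxU (F : _^nat) : (forall i, <<s mx_boxes >> (F i)) ->
  <<s mx_boxes >> (\bigcup_i (F i)).
Proof. exact: sigma_algebra_bigcup. Qed.

HB.instance Definition _ := @isMeasurable.Build default_measure_display
  'M[R]_(m, n) <<s mx_boxes >> mx0 mxC mxU.

Lemma measurable_mx_box (a : 'M[R]_(m, n)) : measurable (mx_box a).
Proof. by apply: sub_sigma_algebra; exists a. Qed.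

Lemma mx_box_setI : setI_closed mx_boxes.
Proof.
move=> _ _ [a _ <-] [b _ <-].
exists (\matrix_(i, j) Num.min (a i j) (b i j)) => //.
apply/seteqP; split => [M h|M [ha hb] i j].
  by split=> i j; have := h i j; rewrite !mxE le_min => /andP[].
by rewrite mxE le_min ha hb.
Qed.

Lemma mx_box_cover (F : nat -> 'M[R]_(m, n)) :
  (forall i j k, k%:R <= F k i j) -> \bigcup_k mx_box (F k) = setT.
Proof.
move=> hF; rewrite -subTset => M _.
exists (\max_(p : 'I_m * 'I_n) (Num.truncn `|M p.1 p.2|).+1)%N => //= i j.
apply: le_trans (hF i j _); rewrite (le_trans (ler_norm _))//.
apply: (le_trans (ltW (truncnS_gt _))); rewrite ler_nat.
exact: (leq_bigmax (i, j)).
Qed.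

Lemma measurable_mxentry i j :
  measurable_fun setT (fun M : 'M[R]_(m, n) => M i j).
Proof.
apply: (measurability _ (RGenOInfty.measurableE R)) => //.
move=> _ [_ [x ->] <-]; rewrite setTI.
(* The half-space of entries at most x is a countable union of orthants: bound x at (i, j) and k,
   tending to infinity, at every other entry. *)
rewrite (_ : _ @^-1` _ = ~` (\bigcup_k mx_box
   (\matrix_(i', j') if (i' == i) && (j' == j) then x else k%:R))).
  by apply: measurableC; apply: bigcupT_measurable => k; exact: measurable_mx_box.
apply/seteqP; split => M /=; rewrite in_itv/= andbT.
  by move=> xM [k _ /(_ i j)]; rewrite mxE !eqxx/= leNgt xM.
apply: contra_notP => /negP; rewrite -leNgt => Mx.
exists (\max_(p : 'I_m * 'I_n) (Num.truncn `|M p.1 p.2|).+1)%N => //= i' j'.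
rewrite mxE; case: ifPn => [/andP[/eqP-> /eqP->]//|_].
rewrite (le_trans (ler_norm _))//.
apply: (le_trans (ltW (truncnS_gt _))); rewrite ler_nat.
exact: (leq_bigmax (i', j')).
Qed.

Lemma measurable_mxP d (T : measurableType d) (f : T -> 'M[R]_(m, n)) :
  measurable_fun setT f <-> forall i j, measurable_fun setT (fun x => f x i j).
Proof.
split=> [mf i j|mf]; first exact: (measurableT_comp (measurable_mxentry i j)).
apply: (measurability mx_boxes) => //.
move=> _ [_ [a _ <-] <-]; rewrite setTI.
rewrite (_ : _ @^-1` _ = \big[setI/setT]_(i < m) \big[setI/setT]_(j < n)
    [set x | f x i j <= a i j]).
  apply: big_ind => //; first exact: measurableI.
  move=> i _; apply: big_ind => //; first exact: measurableI.
  move=> j _; rewrite (_ : mkset _ = (fun x => f x i j) @^-1` `]-oo, a i j]).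
    by rewrite -[X in measurable X]setTI; apply: mf.
  by apply/seteqP; split => x /=; rewrite in_itv.
apply/seteqP; split => x /=.
  by move=> h; rewrite -bigcap_seq => i _; rewrite -bigcap_seq => j _; exact: h.
rewrite -bigcap_seq => h i j; have := h i; rewrite -bigcap_seq; apply => //.
  by rewrite /= mem_index_enum.
by rewrite /= mem_index_enum.
Qed.

(** The pi-lambda theorem; the orthants with constant bound k exhaust the space, and the finite
    total mass makes them sets of finite measure. *)
Lemma eq_measure_mx_box (m1 m2 : {measure set 'M[R]_(m, n) -> \bar R}) :
  (m1 setT < +oo)%E -> (forall a, m1 (mx_box a) = m2 (mx_box a)) ->
  forall A, measurable A -> m1 A = m2 A.
Proof.
move=> m1fin h; apply: (measure_unique mx_boxes
   (fun k => mx_box (const_mx k%:R))) => //.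
- exact: mx_box_setI.
- by move=> i; exists (const_mx i%:R).
- by apply: mx_box_cover => i j k; rewrite mxE.
- by move=> _ [a _ <-].
- move=> k; apply: le_lt_trans m1fin; apply: le_measure; rewrite ?inE//.
  exact: measurable_mx_box.
Qed.

End matrix_sigma_algebra.

(** * Integrability and passage to the limit *)

Section integrability.
Context {R : realType} {d : measure_display} {T : measurableType d}.
Variable mu : {measure set T -> \bar R}.

Lemma le_integrable_fin (f g : T -> R) : measurable_fun setT f ->
  (forall x, `|f x| <= g x) -> mu.-integrable setT (EFin \o g) ->
  mu.-integrable setT (EFin \o f).
Proof.
move=> mf fg; apply: le_integrable => //; first exact/measurable_EFinP.
by move=> x _; rewrite /= lee_fin (le_trans (fg x))// ler_norm.
Qed.

Lemma integrable_mulr_bounded (g h : T -> R) (C : R) :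
  mu.-integrable setT (EFin \o g) -> measurable_fun setT h ->
  (forall x, `|h x| <= C) -> mu.-integrable setT (EFin \o (fun x => g x * h x)).
Proof.
move=> ig mh hC; apply: (@le_integrable_fin _ (fun x => C * `|g x|)).
- by apply: measurable_funM => //; exact/measurable_EFinP/(measurable_int mu).
- by move=> x; rewrite normrM mulrC ler_wpM2r.
- have := @integrableZl _ _ _ mu _ (@measurableT _ T) C _ (integrable_abse ig).
  by apply: eq_integrable => // x _ /=; rewrite EFinM.
Qed.

Lemma bounded_integrable (h : T -> R) (C : R) : (mu setT < +oo)%E ->
  measurable_fun setT h -> (forall x, `|h x| <= C) ->
  mu.-integrable setT (EFin \o h).
Proof.
move=> fmu mh hC; have i1 : mu.-integrable setT (EFin \o cst (1 : R)).
  apply/integrableP; split; first exact/measurable_EFinP/measurable_cst.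
  by under eq_integral do rewrite /= normr1; rewrite integral_cst// mul1e.
have := integrable_mulr_bounded i1 mh hC.
by apply: eq_integrable => // x _ /=; rewrite mul1r.
Qed.

End integrability.

Lemma prob_bounded_integrable {R : realType} {d : measure_display}
    {T : measurableType d} (P : probability T R) (h : T -> R) (C : R) :
  measurable_fun setT h -> (forall x, `|h x| <= C) -> P.-integrable setT (EFin \o h).
Proof.
move=> mh hC; apply: bounded_integrable mh hC.
by apply: (le_lt_trans (probability_le1 P measurableT)); exact: ltry.
Qed.

(** Dominated convergence on both sides at once. The two spaces differ, so the integrals can only be
    compared through their values along the approximating sequences. *)
Lemma eq_integral_dominated {R : realType} {d1 d2 : measure_display}
    {T1 : measurableType d1} {T2 : measurableType d2}
    (m1 : {measure set T1 -> \bar R}) (m2 : {measure set T2 -> \bar R})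
    (f1 : nat -> T1 -> R) (f2 : nat -> T2 -> R) (h1 g1 : T1 -> R) (h2 g2 : T2 -> R) :
  (forall k, measurable_fun setT (f1 k)) -> (forall k, measurable_fun setT (f2 k)) ->
  m1.-integrable setT (EFin \o g1) -> m2.-integrable setT (EFin \o g2) ->
  (forall k x, `|f1 k x| <= g1 x) -> (forall k x, `|f2 k x| <= g2 x) ->
  (forall x, f1 k x @[k --> \oo] --> h1 x) ->
  (forall x, f2 k x @[k --> \oo] --> h2 x) ->
  (forall k, \int[m1]_x (f1 k x)%:E = \int[m2]_x (f2 k x)%:E)%E ->
  (\int[m1]_x (h1 x)%:E = \int[m2]_x (h2 x)%:E)%E.
Proof.
move=> mf1 mf2 ig1 ig2 b1 b2 c1 c2 e.
have l1 : ((\int[m1]_x (f1 k x)%:E)%E @[k --> \oo] --> (\int[m1]_x (h1 x)%:E)%E).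
  apply: (@dominated_cvg _ _ _ m1 _ _ (fun k x => (f1 k x)%:E) _ (EFin \o g1)) => //.
  - by move=> k; exact/measurable_EFinP.
  - by move=> x _; apply: cvg_EFin; [exact: nearW|exact: c1].
  - by move=> k x _ /=; rewrite lee_fin.
have l2 : ((\int[m2]_x (f2 k x)%:E)%E @[k --> \oo] --> (\int[m2]_x (h2 x)%:E)%E).
  apply: (@dominated_cvg _ _ _ m2 _ _ (fun k x => (f2 k x)%:E) _ (EFin \o g2)) => //.
  - by move=> k; exact/measurable_EFinP.
  - by move=> x _; apply: cvg_EFin; [exact: nearW|exact: c2].
  - by move=> k x _ /=; rewrite lee_fin.
have E : (fun k => \int[m1]_x (f1 k x)%:E)%E = (fun k => \int[m2]_x (f2 k x)%:E)%E.
  exact/funext.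
rewrite E in l1; exact: (cvg_unique _ l1 l2).
Qed.

Lemma norm_series_exp_coeff_le {R : realType} (x : R) n :
  `|series (exp_coeff x) n| <= expR `|x|.
Proof.
apply: (@le_trans _ _ (series (exp_coeff `|x|) n)).
  rewrite /series/= (le_trans (ler_norm_sum _ _ _))// ler_sum// => i _.
  by rewrite /exp_coeff/= normrM normrX normfV (ger0_norm (ler0n _ _)).
apply: nondecreasing_cvgn_le; last exact: is_cvg_series_exp_coeff.
by apply: nondecreasing_series => i *; exact: exp_coeff_ge0.
Qed.

Lemma cvg_of_expRN_bound {R : realType} (w : nat -> R) (l : R) :
  (\forall n \near \oo, `|l - w n| <= expR (- n%:R)) -> w n @[n --> \oo] --> l.
Proof.
move=> h; apply/cvgrPdist_le => e e0.
have : (fun n => expR (- n%:R) : R) @ \oo --> (0 : R).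
  have -> : (fun n => expR (- n%:R) : R) = (fun n => expR (- 1) ^+ n).
    by apply/funext => n; rewrite -expRM_natl mulrN1.
  by apply: cvg_expr; rewrite ger0_norm ?expR_ge0// expR_lt1 oppr_lt0.
move/cvgrPdist_le => /(_ e e0) he.
near=> n; apply: (@le_trans _ _ (expR (- n%:R))); first by near: n.
have : `|0 - expR (- n%:R)| <= e by near: n.
by rewrite sub0r normrN ger0_norm ?expR_ge0.
Unshelve. all: by end_near. Qed.

(** * Laplace transforms under a weight of arbitrary sign *)

Section laplace_side.
Context {R : realType} {d : measure_display} {T : measurableType d}.
Variables (mu : {measure set T -> \bar R}) (g u : T -> R).
Hypotheses (ig : mu.-integrable setT (EFin \o g)) (mu_ : measurable_fun setT u)
  (u0 : forall x, 0 <= u x).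

Lemma measurable_expRN (t : R) : measurable_fun setT (fun x => expR (- (t * u x))).
Proof.
by apply: measurableT_comp => //; apply: measurableT_comp => //; exact: measurable_funM.
Qed.

Lemma norm_expRN_le1 (t : R) x : 0 <= t -> `|expR (- (t * u x))| <= 1.
Proof.
by move=> t0; rewrite ger0_norm ?expR_ge0// expR_le1 oppr_le0 mulr_ge0.
Qed.

(** Powers of [exp (- l u)] are again exponentials, so a partial sum of the outer exponential only
    involves the Laplace transform at multiples of l. *)
Lemma integral_series_laplace (C l : R) k : 0 <= l ->
  (\int[mu]_x (g x * series (exp_coeff (- (C * expR (- (l * u x))))) k)%:E =
   \sum_(0 <= i < k) ((- C) ^+ i / i`!%:R)%:E *
     \int[mu]_x (g x * expR (- (l *+ i * u x)))%:E)%E.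
Proof.
move=> l0; have int_i i : mu.-integrable setT
    (EFin \o (fun x => g x * expR (- (l *+ i * u x)))).
  apply: (integrable_mulr_bounded ig (measurable_expRN _)) => x.
  by apply: norm_expRN_le1; rewrite mulrn_wge0.
transitivity (\sum_(0 <= i < k) \int[mu]_x (((- C) ^+ i / i`!%:R)%:E *
     (g x * expR (- (l *+ i * u x)))%:E))%E; last first.
  by apply: eq_bigr => i _; rewrite (integralZl _ (int_i i)).
rewrite -integral_sum//; last by move=> i; exact: (integrableZl _ _ (int_i i)).
apply: eq_integral => x _; rewrite /series/= mulr_sumr -sumEFin.
apply: eq_bigr => i _; rewrite -EFinM; congr EFin.
have -> : expR (- (l *+ i * u x)) = expR (- (l * u x)) ^+ i.
  by rewrite -expRM_natl mulr_natl mulrnAl mulNrn.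
by rewrite /exp_coeff/= -mulNr exprMn; ring.
Qed.
End laplace_side.

(** * Uniqueness of Laplace transforms *)

Section laplace_unique.
Context {R : realType} {d1 d2 : measure_display}
  {T1 : measurableType d1} {T2 : measurableType d2}.
Variables (m1 : {measure set T1 -> \bar R}) (m2 : {measure set T2 -> \bar R})
  (g1 u1 : T1 -> R) (g2 u2 : T2 -> R).
Hypotheses (ig1 : m1.-integrable setT (EFin \o g1)) (mu1 : measurable_fun setT u1)
  (u10 : forall x, 0 <= u1 x) (ig2 : m2.-integrable setT (EFin \o g2))
  (mu2 : measurable_fun setT u2) (u20 : forall x, 0 <= u2 x)
  (lap : forall t, 0 <= t -> (\int[m1]_x (g1 x * expR (- (t * u1 x)))%:E =
                             \int[m2]_x (g2 x * expR (- (t * u2 x)))%:E)%E).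

Let mexp2 d (T : measurableType d) (u : T -> R) (C l : R) : measurable_fun setT u ->
  measurable_fun setT (fun x => expR (- (C * expR (- (l * u x))))).
Proof.
move=> mu; apply: measurableT_comp => //; apply: measurableT_comp => //.
by apply: measurable_funM => //; exact: measurable_expRN.
Qed.

(* Expand the outer exponential: every term is a value of the Laplace transform. *)
Let eq_laplace_exp2 (C l : R) : 0 <= l -> 0 <= C ->
  (\int[m1]_x (g1 x * expR (- (C * expR (- (l * u1 x)))))%:E =
   \int[m2]_x (g2 x * expR (- (C * expR (- (l * u2 x)))))%:E)%E.
Proof.
move=> l0 C0.
have main d (T : measurableType d) (mu : {measure set T -> \bar R}) (g u : T -> R) :
    mu.-integrable setT (EFin \o g) -> measurable_fun setT u ->
    (forall x, 0 <= u x) ->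
    [/\ forall k, measurable_fun setT
          (fun x => g x * series (exp_coeff (- (C * expR (- (l * u x))))) k),
        mu.-integrable setT (EFin \o (fun x => `|g x| * expR C)) ,
        forall k x, `|g x * series (exp_coeff (- (C * expR (- (l * u x))))) k| <=
          `|g x| * expR C &
        forall x, g x * series (exp_coeff (- (C * expR (- (l * u x))))) k @[k --> \oo]
          --> g x * expR (- (C * expR (- (l * u x))))].
  move=> ig mu' u0; split.
  - move=> k; apply: measurable_funM; first exact/measurable_EFinP/(measurable_int mu).
    rewrite /series/=; apply: measurable_sum => i; rewrite /exp_coeff/=.
    apply: measurable_funM => //; apply: measurable_funX.
    by apply: measurableT_comp => //; apply: measurable_funM => //; exact: measurable_expRN.
  - apply: (@integrable_mulr_bounded _ _ _ mu _ _ (expR C)) => //.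
      exact: integrable_norm.
    by move=> x; rewrite ger0_norm ?expR_ge0.
  - move=> k x; rewrite normrM ler_wpM2l//.
    apply: le_trans (norm_series_exp_coeff_le _ _) _.
    rewrite ler_expR normrN normrM (ger0_norm C0) ler_piMr//.
    exact: norm_expRN_le1.
  - move=> x; apply: cvgMl_tmp.
    exact: is_cvg_series_exp_coeff.
have [a1 b1 c1 e1] := main _ _ _ _ _ ig1 mu1 u10.
have [a2 b2 c2 e2] := main _ _ _ _ _ ig2 mu2 u20.
apply: (eq_integral_dominated a1 a2 b1 b2 c1 c2 e1 e2) => k.
rewrite !integral_series_laplace//; apply: eq_bigr => i _.
by rewrite lap// mulrn_wge0.
Qed.

(** The inner quantity is [exp (n^2 (a - u) + n)]: it tends to infinity for u < a and to 0 for u >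
    a. The extra n settles the boundary case u = a in favour of the closed half-line. *)
Let cvg_step (u a : R) :
  (1 - expR (- (expR (n%:R ^+ 2 * a + n%:R) * expR (- (n%:R ^+ 2 * u))))) @[n --> \oo]
   --> ((u <= a)%R%:R : R).
Proof.
apply: cvg_of_expRN_bound.
have [ua|au] := leP u a.
  near=> n; rewrite opprB addrC subrK ger0_norm ?expR_ge0// ler_expR lerN2 -expRD.
  rewrite (le_trans _ (expR_ge1Dx _))//.
  have : 0 <= n%:R ^+ 2 * (a - u) by rewrite mulr_ge0 ?sqr_ge0// subr_ge0.
  lra.
near=> n; rewrite sub0r normrN -expRD ger0_norm; last first.
  by rewrite subr_ge0 expR_le1 oppr_le0 expR_ge0.
apply: (@le_trans _ _ (expR (n%:R ^+ 2 * a + n%:R - n%:R ^+ 2 * u))).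
  by rewrite lerBlDl addrC -lerBlDl (le_trans _ (expR_ge1Dx _))// addrC.
rewrite ler_expR.
(* Then [n^2 (u - a)] is at least 2n, which outweighs the extra n and leaves the rate
   [exp (- n)]. *)
have H : 2 <= n%:R * (u - a).
  rewrite -ler_pdivrMr ?subr_gt0//; near: n; exact: nbhs_infty_ger.
have : n%:R * 2 <= n%:R * (n%:R * (u - a)) by rewrite ler_wpM2l.
rewrite expr2; lra.
Unshelve. all: by end_near. Qed.

(** The indicator of a half-line is a bounded pointwise limit of double exponentials, whose
    integrals are determined by the Laplace transform. *)
Lemma eq_laplace_le (a : R) :
  (\int[m1]_x (g1 x * (u1 x <= a)%R%:R)%:E = \int[m2]_x (g2 x * (u2 x <= a)%R%:R)%:E)%E.
Proof.
pose f n u : R := 1 - expR (- (expR (n%:R ^+ 2 * a + n%:R) * expR (- (n%:R ^+ 2 * u)))).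
have fb n u : `|f n u| <= 1.
  by rewrite ger0_norm /f ?subr_ge0 ?expR_le1 ?oppr_le0 ?mulr_ge0 ?expR_ge0// gerBl expR_ge0.
have main d (T : measurableType d) (mu : {measure set T -> \bar R}) (g u : T -> R) :
    mu.-integrable setT (EFin \o g) -> measurable_fun setT u ->
    [/\ forall n, measurable_fun setT (fun x => g x * f n (u x)),
     mu.-integrable setT (EFin \o (fun x => `|g x|)),
     forall n x, `|g x * f n (u x)| <= `|g x| &
     forall x, g x * f n (u x) @[n --> \oo] --> g x * (u x <= a)%R%:R].
  move=> ig mu'; split.
  - move=> n; apply: measurable_funM; first exact/measurable_EFinP/(measurable_int mu).
    by apply: measurable_funB => //; exact: mexp2.
  - exact: integrable_norm.
  - by move=> n x; rewrite normrM ler_piMr.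
  - by move=> x; apply: cvgMl_tmp; exact: cvg_step.
have [a1 b1 c1 e1] := main _ _ _ _ _ ig1 mu1.
have [a2 b2 c2 e2] := main _ _ _ _ _ ig2 mu2.
apply: (eq_integral_dominated a1 a2 b1 b2 c1 c2 e1 e2) => n.
(* The constant 1 in [f] is written as [exp (- (0 * u))], so that its integral is the Laplace
   transform at 0. *)
have sub d (T : measurableType d) (mu : {measure set T -> \bar R}) (g u : T -> R) :
    mu.-integrable setT (EFin \o g) -> measurable_fun setT u ->
  (\int[mu]_x (g x * f n (u x))%:E = \int[mu]_x (g x * expR (- (0 * u x)))%:E -
   \int[mu]_x (g x * expR (- (expR (n%:R ^+ 2 * a + n%:R) * expR (- (n%:R ^+ 2 * u x)))))%:E)%E.
  move=> ig mu'; rewrite -integralB_EFin//.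
  - by apply: eq_integral => x _; rewrite mul0r oppr0 expR0 mulr1 /f mulrBr mulr1 EFinB.
  - by apply: eq_integrable ig => // x _ /=; rewrite mul0r oppr0 expR0 mulr1.
  - apply: (integrable_mulr_bounded ig (mexp2 _ _ mu') (C := 1)) => x.
    by rewrite ger0_norm ?expR_ge0// expR_le1 oppr_le0 mulr_ge0 ?expR_ge0.
rewrite !sub// lap// eq_laplace_exp2 ?sqr_ge0 ?expR_ge0//.
Qed.

End laplace_unique.

(** * Normal integrals *)

Lemma normal_pdf0E {R : realType} (sg x : R) : sg != 0 ->
  normal_pdf 0 sg x = normal_peak sg * expR (- (sg ^+ 2 *+ 2)^-1 * x ^+ 2).
Proof.
by move=> sg0; rewrite normal_pdfE// /normal_fun subr0 mulNr mulNr [in LHS](mulrC (x ^+ 2)).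
Qed.

Section normal_charfn.
Context {R : realType}.
Variables (sg : R) (sg0 : sg != 0).
Local Notation mu := (@lebesgue_measure R).
Local Notation p := (normal_pdf 0 sg).

Lemma is_derive_expR_sqr (x k a : R) :
  is_derive x (1:R) (fun y => k * expR (a * y ^+ 2)) (k * (2 * a * x * expR (a * x ^+ 2))).
Proof.
have h1 : is_derive x (1:R) (fun y => a * y ^+ 2) (a * (2 * x)).
  apply: (@is_derive_eq _ _ _ (cst a * (id ^+ 2))).
  by rewrite /= /GRing.scale/= mulr1 expr1 mulr0 addr0.
have h2 := @is_derive1_comp _ expR _ x _ _ (is_derive_expR _) h1.
apply: (@is_derive_eq _ _ _ (cst k * (expR \o (fun y => a * y ^+ 2)))).
by rewrite /= /GRing.scale/= /cst; ring.
Qed.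

Lemma is_derive_normal_pdf (x : R) : is_derive x (1:R) p (- (x / sg ^+ 2) * p x).
Proof.
have -> : p = fun x => normal_peak sg * expR (- (sg ^+ 2 *+ 2)^-1 * x ^+ 2).
  by apply/funext => y; rewrite normal_pdf0E.
apply: (is_derive_eq (is_derive_expR_sqr _ _ _)).
rewrite [RHS]mulrCA; congr (_ * _); congr (_ * _).
by rewrite -mulr_natr; field; rewrite sg0.
Qed.

Lemma is_derive_cos_affine (x c s : R) :
  is_derive s (1:R) (fun s => cos (s * x + c)) (- (x * sin (s * x + c))).
Proof.
have h : is_derive s (1:R) (fun s => s * x + c) x.
  apply: (@is_derive_eq _ _ _ (id * cst x + cst c)).
  by rewrite /= /GRing.scale/= mulr0 add0r addr0 mulr1.
apply: (is_derive_eq (@is_derive1_comp _ cos _ s _ _ (is_derive_cos _) h)).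
by rewrite mulNr mulrC.
Qed.

Lemma is_derive_sin_affine (x c s : R) :
  is_derive x (1:R) (fun x => sin (s * x + c)) (s * cos (s * x + c)).
Proof.
have h : is_derive x (1:R) (fun x => s * x + c) s.
  apply: (@is_derive_eq _ _ _ (cst s * id + cst c)).
  by rewrite /= /GRing.scale/= mulr0 !addr0 mulr1.
apply: (is_derive_eq (@is_derive1_comp _ sin _ x _ _ (is_derive_sin _) h)).
by rewrite mulrC.
Qed.

Lemma measurable_cos_affine d (T : measurableType d) (f : T -> R) (s c : R) :
  measurable_fun setT f -> measurable_fun setT (fun x => cos (s * f x + c)).
Proof.
move=> mf; apply: (measurableT_comp (continuous_measurable_fun (@continuous_cos R))).
by apply: measurable_funD => //; exact: measurable_funM.
Qed.

Lemma measurable_sin_affine d (T : measurableType d) (f : T -> R) (s c : R) :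
  measurable_fun setT f -> measurable_fun setT (fun x => sin (s * f x + c)).
Proof.
move=> mf; apply: (measurableT_comp (continuous_measurable_fun (@continuous_sin R))).
by apply: measurable_funD => //; exact: measurable_funM.
Qed.

Lemma norm_cos_le1 (x : R) : `|cos x| <= 1.
Proof. by rewrite ler_norml cos_geN1 cos_le1. Qed.

Lemma norm_sin_le1 (x : R) : `|sin x| <= 1.
Proof. by rewrite ler_norml sin_geN1 sin_le1. Qed.

Let K := `|sg| * normal_peak sg.

(** With y = x^2 / (4 sg^2), [1 + y <= exp y] and the square (1 - |x| / (2 |sg|))^2 give |x| <= |sg|
    exp y. One of the two factors [exp (- y)] of the density is spent on this, and what remains is a
    Gaussian of doubled variance. *)
Let norm_x_pdf (x : R) :
  `|x| * p x <= K * expR (- ((Num.sqrt 2 * sg) ^+ 2 *+ 2)^-1 * x ^+ 2).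
Proof.
suff h : `|x| * expR (- (sg ^+ 2 *+ 2)^-1 * x ^+ 2) <=
    `|sg| * expR (- ((Num.sqrt 2 * sg) ^+ 2 *+ 2)^-1 * x ^+ 2).
  have := ler_wpM2l (normal_peak_ge0 sg) h.
  by rewrite normal_pdf0E// /K mulrCA [leRHS]mulrA [normal_peak sg * `|sg|]mulrC.
rewrite exprMn sqr_sqrtr//.
have sq : 0 < sg ^+ 2 by rewrite exprn_even_gt0.
pose y := (sg ^+ 2 *+ 2 *+ 2)^-1 * x ^+ 2.
have -> : - (sg ^+ 2 *+ 2)^-1 * x ^+ 2 = - y - y.
  by rewrite /y; field; rewrite sg0.
have -> : - (2 * sg ^+ 2 *+ 2)^-1 * x ^+ 2 = - y.
  by rewrite /y; field; rewrite sg0.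
rewrite expRD mulrA ler_wpM2r ?expR_ge0//.
rewrite expRN ler_pdivrMr ?expR_gt0//.
have nsg : 0 < `|sg| by rewrite normr_gt0.
rewrite -ler_pdivrMl//.
apply: le_trans (expR_ge1Dx _).
have -> : y = (`|sg|^-1 * `|x|) ^+ 2 / 4.
  rewrite /y exprMn exprVn !real_normK ?num_real//; field.
  by rewrite sg0.
have := sqr_ge0 (1 - (`|sg|^-1 * `|x|) / 2); lra.
Qed.

(** Supplies the dominating function for differentiating the characteristic function under the
    integral sign. *)
Lemma integrable_x_normal_pdf : mu.-integrable setT (EFin \o (fun x => `|x| * p x)).
Proof.
have s20 : Num.sqrt 2 * sg != 0 by rewrite mulf_neq0// sqrtr_eq0 -ltNge.
apply: (@le_integrable_fin _ _ _ mu _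
  (fun x => (K / normal_peak (Num.sqrt 2 * sg)) * normal_pdf 0 (Num.sqrt 2 * sg) x)).
- by apply: measurable_funM; [exact: normr_measurable|exact: measurable_normal_pdf].
- move=> x; rewrite ger0_norm ?mulr_ge0 ?normal_pdf_ge0//.
  apply: le_trans (norm_x_pdf x) _.
  by rewrite normal_pdf0E// [leRHS]mulrA mulfVK ?gt_eqF ?normal_peak_gt0.
- have := @integrableZl _ _ _ mu _ measurableT (K / normal_peak (Num.sqrt 2 * sg)) _
    (integrable_normal_pdf 0 (Num.sqrt 2 * sg)).
  by apply: eq_integrable => // x _ /=; rewrite EFinM.
Qed.

(** Makes the boundary terms of the integration by parts vanish. *)
Lemma normal_pdf_nat_le n : p n.+1%:R <= K / n.+1%:R.
Proof.
rewrite ler_pdivlMr// mulrC; have := norm_x_pdf n.+1%:R; rewrite ger0_norm// => h.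
apply: le_trans h _; rewrite ler_piMr ?mulr_ge0 ?normal_peak_ge0//.
by rewrite expR_le1 mulNr oppr_le0 mulr_ge0 ?sqr_ge0// invr_ge0 mulrn_wge0// sqr_ge0.
Qed.

(** The derivative of [- (sin (s * x + c) * p x)]. *)
Let k s c (x : R) := (x / sg ^+ 2 * sin (s * x + c) - s * cos (s * x + c)) * p x.

Let mk s c : measurable_fun setT (k s c).
Proof.
apply: measurable_funM; last exact: measurable_normal_pdf.
apply: measurable_funB; apply: measurable_funM => //.
- exact: measurable_funM.
- exact: measurable_sin_affine.
- exact: measurable_cos_affine.
Qed.

Let k_le s c x : `|k s c x| <= (sg ^+ 2)^-1 * (`|x| * p x) + `|s| * p x.
Proof.
have sq : 0 < sg ^+ 2 by rewrite exprn_even_gt0.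
rewrite normrM (ger0_norm (normal_pdf_ge0 _ _ _)) mulrA -mulrDl.
rewrite ler_wpM2r ?normal_pdf_ge0// (le_trans (ler_normB _ _))// lerD//.
  rewrite 2!normrM normfV (ger0_norm (ltW sq)) [leRHS]mulrC ler_piMr ?norm_sin_le1//.
  by rewrite mulr_ge0// invr_ge0 ltW.
by rewrite normrM ler_piMr ?norm_cos_le1.
Qed.

Let int_dom a b : mu.-integrable setT (EFin \o (fun x => a * (`|x| * p x) + b * p x)).
Proof.
have h1 := @integrableZl _ _ _ mu _ measurableT a _ integrable_x_normal_pdf.
have h2 := @integrableZl _ _ _ mu _ measurableT b _ (integrable_normal_pdf 0 sg).
by apply: eq_integrable (integrableD measurableT h1 h2).
Qed.

Let continuous_normal : continuous p.
Proof. exact: continuous_normal_pdf. Qed.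

Let integral_k_itv s c n : (\int[mu]_(x in `[(- n.+1%:R)%R, n.+1%:R%R]) (k s c x)%:E =
  (- (sin (s * n.+1%:R + c) * p n.+1%:R) +
     sin (- (s * n.+1%:R) + c) * p (- n.+1%:R))%R%:E)%E.
Proof.
pose F x := - (sin (s * x + c) * p x).
have dF x : is_derive x (1:R) F (k s c x).
  have := is_derive_sin_affine x c s; have := is_derive_normal_pdf x => h1 h2.
  apply: (@is_derive_eq _ _ _ (- ((fun x => sin (s * x + c)) * p))).
  by rewrite /k/= /GRing.scale/=; ring.
have cont (f : R -> R) x (df : R) : is_derive x (1:R) f df -> {for x, continuous f}.
  by case=> df1 _; apply: differentiable_continuous; exact/derivable1_diffP.
have ck : continuous (k s c).
  move=> x; apply: cvgM; last exact: continuous_normal.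
  apply: cvgB; apply: cvgM => //.
  - by apply: cvgMr_tmp; exact: cvg_id.
  - exact: (cont _ _ _ (is_derive_sin_affine x c s)).
  - exact: cvg_cst.
  - have -> : (fun x => cos (s * x + c)) = (fun x => cos (x * s + c)).
      by apply/funext => y; rewrite mulrC.
    by rewrite [s * x]mulrC; exact: (cont _ _ _ (is_derive_cos_affine s c x)).
rewrite (@continuous_FTC2 _ _ F) //.
- by rewrite /F mulrN -EFinB opprK.
- by rewrite (@lt_trans _ _ 0)// oppr_lt0.
- exact: continuous_subspaceT.
- split.
  + by move=> x _; case: (dF x).
  + by apply: cvg_at_right_filter; exact: (cont _ _ _ (dF _)).
  + by apply: cvg_at_left_filter; exact: (cont _ _ _ (dF _)).
- by move=> x _; rewrite derive1E; case: (dF x).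
Qed.

(** Stein's identity for the sine: the integral of a derivative over [-(n+1), n+1] consists of
    boundary terms, which are O(1/n). *)
Lemma normal_stein s c : (\int[mu]_x (k s c x)%:E = 0)%E.
Proof.
have l1 : ((\int[mu]_(x in `[(- n.+1%:R)%R, n.+1%:R%R]) (k s c x)%:E)%E @[n --> \oo]
    --> (\int[mu]_x (k s c x)%:E)%E).
  under eq_cvg do rewrite integral_mkcond.
  apply: (@dominated_cvg _ _ _ mu _ _ _ _
    (EFin \o (fun x => (sg ^+ 2)^-1 * (`|x| * p x) + `|s| * p x))) => //.
  - move=> n; apply: (measurable_restrictT _ _).1 => //.
    by apply/measurable_EFinP/measurable_funTS; exact: mk.
  - move=> x _; apply: cvg_near_cst; near=> n.
    rewrite patchE mem_set//= in_itv/= -ler_norml.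
    apply: (@le_trans _ _ n%:R); last by rewrite ler_nat.
    by near: n; exact: nbhs_infty_ger.
  - move=> n x _; rewrite patchE; case: ifPn => _; first by rewrite /= lee_fin k_le.
    by rewrite abse0 lee_fin (le_trans _ (k_le s c x)).
have l2 : ((\int[mu]_(x in `[(- n.+1%:R)%R, n.+1%:R%R]) (k s c x)%:E)%E @[n --> \oo]
    --> 0%E).
  under eq_cvg do rewrite integral_k_itv.
  apply: cvg_EFin; first exact: nearW.
  rewrite /comp/=; apply/norm_cvg0P.
  apply: (@squeeze_cvgr _ _ _ _ (cst 0) (fun n => (2 * K) * (n.+1%:R)^-1)).
  - apply: nearW => n; rewrite normr_ge0/= (le_trans (ler_normD _ _))//.
    have pN : p (- n.+1%:R) = p n.+1%:R by rewrite !normal_pdf0E// sqrrN.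
    rewrite normrN !normrM pN (ger0_norm (normal_pdf_ge0 _ _ _)).
    apply: (@le_trans _ _ (p n.+1%:R + p n.+1%:R)).
      by rewrite lerD// ler_piMl ?normal_pdf_ge0// norm_sin_le1.
    by rewrite -mulrA mulr_natl mulr2n lerD// normal_pdf_nat_le.
  - exact: cvg_cst.
  - rewrite -[X in _ --> X](mulr0 (2 * K)); apply: cvgMl_tmp.
    exact: cvg_harmonic.
exact: (cvg_unique _ l1 l2).
Unshelve. all: by end_near. Qed.

End normal_charfn.

Section normal_charfn2.
Context {R : realType}.
Variables (sg : R) (sg0 : sg != 0).
Local Notation mu := (@lebesgue_measure R).
Local Notation p := (normal_pdf 0 sg).

Let F c s : R := (\int[mu]_(x in setT) (cos (s * x + c) * p x))%R.

Let int_cos c s : mu.-integrable setT (EFin \o (fun x => cos (s * x + c) * p x)).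
Proof.
apply: (le_integrable_fin _ _ (integrable_normal_pdf 0 sg)).
  by apply: measurable_funM; [exact: measurable_cos_affine|exact: measurable_normal_pdf].
by move=> x; rewrite normrM (ger0_norm (normal_pdf_ge0 _ _ _)) ler_piMl ?normal_pdf_ge0 ?norm_cos_le1.
Qed.

Let int_sin c s : mu.-integrable setT (EFin \o (fun x => x * sin (s * x + c) * p x)).
Proof.
apply: (le_integrable_fin _ _ (integrable_x_normal_pdf sg0)).
  apply: measurable_funM; last exact: measurable_normal_pdf.
  by apply: measurable_funM => //; exact: measurable_sin_affine.
move=> x; rewrite 2!normrM (ger0_norm (normal_pdf_ge0 _ _ _)).
by rewrite ler_wpM2r ?normal_pdf_ge0// ler_piMr// norm_sin_le1.
Qed.

(** Differentiation under the integral produces the mean of - x sin (s x + c), which Stein's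
    identity turns back into a multiple of [F c s]: a linear differential equation. *)
Let dF c s : is_derive s (1:R) (F c) (- (sg ^+ 2 * s) * F c s).
Proof.
pose f s (x : R) := cos (s * x + c) * p x.
have df s' x : is_derive s' (1:R) (f ^~ x) (- (x * sin (s' * x + c) * p x)).
  have := is_derive_cos_affine x c s' => h.
  apply: (@is_derive_eq _ _ _ ((fun s => cos (s * x + c)) * cst (p x))).
  by rewrite /= /GRing.scale/= mulr0 add0r mulrC mulNr.
have d1f s' x : partial1of2 f s' x = - (x * sin (s' * x + c) * p x).
  by rewrite partial1of2E; case: (df s' x).
have Is : `]s - 1, s + 1[%classic s by rewrite /= in_itv/=; apply/andP; split; lra.
have h1 : forall x, `]s - 1, s + 1[%classic x -> mu.-integrable setT (EFin \o f x).
  by move=> x _; exact: int_cos.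
have h2 : forall x y, `]s - 1, s + 1[%classic x -> setT y -> derivable (f ^~ y) x 1.
  by move=> x y _ _; case: (df x y).
have G0 y : 0 <= `|y| * p y by rewrite mulr_ge0// normal_pdf_ge0.
have Gub x y : `]s - 1, s + 1[%classic x -> setT y -> `|partial1of2 f x y| <= `|y| * p y.
  move=> _ _; rewrite d1f normrN 2!normrM (ger0_norm (normal_pdf_ge0 _ _ _)).
  by rewrite ler_wpM2r ?normal_pdf_ge0// ler_piMr// norm_sin_le1.
split; first exact: (derivable_under_integral measurableT Is h1 h2 G0
  (integrable_x_normal_pdf sg0) Gub).
rewrite -derive1E (differentiation_under_integral measurableT Is h1 h2 G0
  (integrable_x_normal_pdf sg0) Gub).
(* The integrand is split into - sg^2 times the exact derivative, which integrates to 0, and a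
   multiple of the integrand of [F]. *)
have e1 : (\int[mu]_(y in setT) partial1of2 f s y)%R =
   (\int[mu]_(x in setT) (- sg ^+ 2 * ((x / sg ^+ 2 * sin (s * x + c) - s * cos (s * x + c)) * p x)
      + - (sg ^+ 2 * s) * (cos (s * x + c) * p x)))%R.
  by apply: eq_Rintegral => x _; rewrite d1f; field.
have ik : mu.-integrable setT (EFin \o (fun x =>
    (x / sg ^+ 2 * sin (s * x + c) - s * cos (s * x + c)) * p x)).
  have a1 := @integrableZl _ _ _ mu _ measurableT (sg ^+ 2)^-1 _ (int_sin c s).
  have a2 := @integrableZl _ _ _ mu _ measurableT (- s) _ (int_cos c s).
  apply: eq_integrable (integrableD measurableT a1 a2) => // x _ /=.
  by rewrite -!EFinM -EFinD; congr EFin; field.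
rewrite e1 RintegralD//; last 2 first.
- by have := @integrableZl _ _ _ mu _ measurableT (- sg ^+ 2) _ ik.
- by have := @integrableZl _ _ _ mu _ measurableT (- (sg ^+ 2 * s)) _ (int_cos c s).
rewrite !RintegralZl//.
by rewrite [X in - _ * X + _]/Rintegral normal_stein// fine0 mulr0 add0r.
Qed.

(** Multiplying by the integrating factor [exp (sg^2 s^2 / 2)] gives a function of zero derivative,
    evaluated at s = 0. *)
Lemma normal_charfn_lebesgue s c :
  (\int[mu]_x (cos (s * x + c) * p x)%:E = (expR (- (s * sg) ^+ 2 / 2) * cos c)%:E)%E.
Proof.
have F0 : F c 0 = cos c.
  rewrite /F /Rintegral.
  under eq_integral do rewrite mul0r add0r EFinM.
  by rewrite integralZl ?integrable_normal_pdf// integral_normal_pdf mule1.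
have h : F c s = expR (- (s * sg) ^+ 2 / 2) * cos c.
  have d x : is_derive x (1:R) (fun s => F c s * expR ((sg ^+ 2 / 2) * s ^+ 2)) 0.
    have h1 := dF c x; have h2 := is_derive_expR_sqr x 1 (sg ^+ 2 / 2).
    have -> : (fun s => F c s * expR ((sg ^+ 2 / 2) * s ^+ 2)) =
        (F c * (fun s => 1 * expR ((sg ^+ 2 / 2) * s ^+ 2))).
      by apply/funext => y; rewrite -[in LHS](mul1r (expR _)).
    apply: is_derive_eq.
    by rewrite /= /GRing.scale/=; field.
  have /= := @is_derive_0_is_cst _ _ s 0 d.
  rewrite expr0n/= mulr0 expR0 mulr1 F0 => <-.
  rewrite mulrCA -expRD (_ : _ + _ = 0) ?expR0 ?mulr1//.
  by rewrite exprMn; field.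
by rewrite -h /F /Rintegral fineK//; exact: (integrable_fin_num _ (int_cos c s)).
Qed.

End normal_charfn2.

Lemma integral_normal_prob {R : realType} (m s : R) (f : R -> R) : s != 0 -> measurable_fun setT f ->
  (normal_prob m s).-integrable setT (EFin \o f) ->
  (\int[normal_prob m s]_x (f x)%:E = \int[lebesgue_measure]_x (f x * normal_pdf m s x)%:E)%E.
Proof.
move=> s0 mf intf.
have dom := normal_prob_dominates m s.
rewrite -(Radon_Nikodym_change_of_variables dom)//=.
apply: ae_eq_integral => //.
- by apply: emeasurable_funM => //; exact/measurable_EFinP.
- by apply/measurable_EFinP/measurable_funM => //; exact: measurable_normal_pdf.
- under [X in ae_eq _ _ _ X]eq_fun do rewrite EFinM.
  apply: ae_eqe_mul2l => /=.
  rewrite Radon_NikodymE//=; case: cid => /= h [h1 h2 h3].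
  apply: integral_ae_eq => //=.
  + by apply/measurable_EFinP; exact: measurable_normal_pdf.
  + by move=> E E01 mE; rewrite -h3.
Qed.

Lemma normal_charfn {R : realType} (sg s c : R) : sg != 0 ->
  (\int[normal_prob 0 sg]_x (cos (s * x + c))%:E =
   (expR (- (s * sg) ^+ 2 / 2) * cos c)%:E)%E.
Proof.
move=> sg0; have mc : measurable_fun setT (fun x : R => cos (s * x + c)).
  exact: (@measurable_cos_affine _ _ _ id).
rewrite integral_normal_prob// ?normal_charfn_lebesgue//.
apply: (@prob_bounded_integrable _ _ _ (normal_prob 0 sg) _ 1) => [|x].
- exact: mc.
- exact: norm_cos_le1.
Qed.

(** Completion of the square. Nonnegativity of the exponent bounds the integrand by 1, which gives
    its integrability under the normal law. *)
Lemma normal_gauss_transform {R : realType} (b c e : R) : 0 <= c ->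
  (forall x, 0 <= e + b * x + c * x ^+ 2 / 2) ->
  (\int[normal_prob 0 1]_x (expR (- (e + b * x + c * x ^+ 2 / 2)))%:E =
   ((Num.sqrt (1 + c))^-1 * expR (- e + b ^+ 2 / (2 * (1 + c))))%:E)%E.
Proof.
move=> c0 q0; have c1 : 0 < 1 + c by lra.
have mq : measurable_fun setT (fun x : R => expR (- (e + b * x + c * x ^+ 2 / 2))).
  apply: measurableT_comp => //; apply: measurableT_comp => //.
  apply: measurable_funD; first by apply: measurable_funD => //; exact: measurable_funM.
  by apply: measurable_funM => //; apply: measurable_funM => //; exact: measurable_funX.
rewrite integral_normal_prob//; last first.
  apply: (@prob_bounded_integrable _ _ _ (normal_prob 0 1) _ 1) => [|x].
  - exact: mq.
  - by rewrite ger0_norm ?expR_ge0// expR_le1 oppr_le0.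
(* Mean and standard deviation of the normal density left after completing the square in
   [(1 + c) x^2 / 2 + b x]. *)
pose s := (Num.sqrt (1 + c))^-1; pose m := - b / (1 + c).
have sg0 : 0 < Num.sqrt (1 + c) by rewrite sqrtr_gt0.
have s0 : s != 0 by rewrite invr_eq0 gt_eqF.
have s2 : s ^+ 2 = (1 + c)^-1 by rewrite exprVn sqr_sqrtr// ltW.
have peak : normal_peak 1 = s * normal_peak s.
  rewrite /normal_peak s2 expr1n mul1r -mulrnAr sqrtrM; last by rewrite invr_ge0 ltW.
  rewrite sqrtrV ?(ltW c1)// invfM invrK -/s mulrA /s mulVf ?mul1r//.
  by rewrite gt_eqF.
transitivity (\int[lebesgue_measure]_x
  ((s * expR (- e + b ^+ 2 / (2 * (1 + c))))%:E * (normal_pdf m s x)%:E))%E.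
  apply: eq_integral => x _; rewrite -EFinM; congr EFin.
  rewrite !normal_pdfE ?oner_neq0// /normal_fun peak.
  have key : expR (- (e + b * x + c * x ^+ 2 / 2)) * expR (- (x - 0) ^+ 2 / (1 ^+ 2 *+ 2)) =
      expR (- e + b ^+ 2 / (2 * (1 + c))) * expR (- (x - m) ^+ 2 / (s ^+ 2 *+ 2)).
    by rewrite -!expRD; congr expR; rewrite s2 expr1n /m; field; rewrite gt_eqF.
  by rewrite mulrCA [LHS]mulrC key; ring.
by rewrite integralZl// ?integrable_normal_pdf// integral_normal_pdf mule1.
Qed.

(** * Uniqueness of characteristic functions *)

Section weighted_law.
Local Open Scope ereal_scope.
Context {R : realType} {d d' : measure_display}
  {T : measurableType d} {V : measurableType d'}.
Variables (mu : {measure set T -> \bar R}) (g : T -> R) (X : T -> V).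
Hypotheses (g0 : forall x, (0 <= g x)%R) (ig : mu.-integrable setT (EFin \o g))
  (mX : measurable_fun setT X).

Let mg : measurable_fun setT g.
Proof. exact/measurable_EFinP/(measurable_int mu). Qed.

(** The image under [X] of the measure with density [g]. A weight lets the law biased by a
    determinant and an ordinary law pass through the same uniqueness argument. *)
Definition wlaw (A : set V) : \bar R := \int[mu]_(x in X @^-1` A) (g x)%:E.

Let wlaw0 : wlaw set0 = 0.
Proof. by rewrite /wlaw preimage_set0 integral_set0. Qed.

Let wlaw_ge0 A : 0 <= wlaw A.
Proof. by apply: integral_ge0 => x _; rewrite lee_fin. Qed.

Let mpre A : measurable A -> measurable (X @^-1` A).
Proof. by move=> mA; rewrite -[X in measurable X]setTI; exact: mX. Qed.

Let wlaw_sigma_additive : semi_sigma_additive wlaw.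
Proof.
move=> F mF tF mUF; rewrite /wlaw preimage_bigcup ge0_integral_bigcup//.
- by apply: is_cvg_ereal_nneg_natsum_cond => n _ _; exact: wlaw_ge0.
- by move=> n; exact: mpre.
- exact/measurable_funTS/measurable_EFinP.
- by move=> x _; rewrite lee_fin.
- apply/trivIsetP => i j _ _ ij; rewrite -preimage_setI.
  by move/trivIsetP : tF => /(_ _ _ _ _ ij) ->//; rewrite preimage_set0.
Qed.

Definition wlaw_measure : {measure set V -> \bar R} :=
  HB.pack wlaw (isMeasure.Build _ _ _ wlaw wlaw0 wlaw_ge0 wlaw_sigma_additive).

Import HBNNSimple.

Let integral_wlaw_nnsfun (h : {nnsfun V >-> R}) :
  \int[wlaw_measure]_y (h y)%:E = \int[mu]_x ((g x)%:E * (h (X x))%:E).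
Proof.
under [LHS]eq_integral do rewrite fimfunE -fsumEFin//.
rewrite [LHS]ge0_integral_fsum//; last 2 first.
  - by move=> r; exact/measurable_EFinP/measurableT_comp.
  - by move=> n x _; rewrite EFinM nnfun_muleindic_ge0.
under [RHS]eq_integral.
  move=> x xD; rewrite fimfunE -fsumEFin// ge0_mule_fsumr; last first.
    by move=> r; rewrite EFinM nnfun_muleindic_ge0.
  over.
have mh r : measurable (h @^-1` [set r]) by [].
rewrite [RHS]ge0_integral_fsum//; last 2 first.
  - move=> r; apply: emeasurable_funM; first exact/measurable_EFinP.
    apply/measurable_EFinP; apply: measurable_funM => //.
    by apply: (measurableT_comp (measurable_indic _) mX); exact: mh.
  - move=> r x _; rewrite mule_ge0 ?lee_fin// -lee_fin EFinM.
    by rewrite nnfun_muleindic_ge0.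
apply: eq_fsbigr => r _.
rewrite integralZl_indic_nnsfun// integral_indic// setIT.
have [r0|r0] := ltP r 0%R.
  have -> : h @^-1` [set r] = set0.
    by apply/seteqP; split => // y /= hy; move: r0; rewrite -hy ltNge fun_ge0.
  rewrite measure0 mule0; symmetry; apply: integral0_eq => x _.
  by rewrite indic0 mulr0 mule0.
rewrite [X in _ * X = _]/(wlaw _) /wlaw integral_mkcond -ge0_integralZl//.
- apply: eq_integral => x _; rewrite patchE indicE.
  rewrite (_ : (x \in _) = (X x \in h @^-1` [set r])); last first.
    by apply/idP/idP; rewrite !inE.
  by case: ifPn => _; rewrite /= ?mulr1 ?mulr0 ?mule0// muleC.
- apply: (measurable_restrictT _ _).1; first exact: mpre.
  exact/measurable_funTS/measurable_EFinP.
- by move=> x _; rewrite patchE; case: ifP; rewrite // lee_fin.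
Qed.

(** Change of variables, from simple functions by monotone convergence. *)
Lemma integral_wlaw (f : V -> \bar R) : measurable_fun setT f -> (forall y, 0 <= f y) ->
  \int[wlaw_measure]_y f y = \int[mu]_x ((g x)%:E * f (X x)).
Proof.
move=> mf f0; pose f_ := nnsfun_approx measurableT mf.
have fE y : f y = lim ((f_ n y)%:E @[n --> \oo]).
  by apply/esym/cvg_lim => //=; exact: cvg_nnsfun_approx.
have nd y : {homo (fun n => (f_ n y)%:E) : a b / (a <= b)%N >-> a <= b}.
  by move=> a b ab; rewrite lee_fin; exact/lefP/nd_nnsfun_approx.
transitivity (lim (\int[wlaw_measure]_y (f_ n y)%:E @[n --> \oo])).
  rewrite -monotone_convergence//.
  - by apply: eq_integral => y _; exact: fE.
  - by move=> n; exact/measurable_EFinP/measurable_funTS.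
  - by move=> n y _; rewrite lee_fin.
have -> : (fun n => \int[wlaw_measure]_y (f_ n y)%:E) =
    (fun n => \int[mu]_x ((g x)%:E * (f_ n (X x))%:E)).
  by apply/funext => n; exact: integral_wlaw_nnsfun.
rewrite -monotone_convergence//=.
- apply: eq_integral => x _; rewrite fE limeMl//.
  exact: ereal_nondecreasing_is_cvgn.
- move=> n; apply/measurable_EFinP; apply: measurable_funM => //.
  exact: measurableT_comp.
- by move=> n y _; rewrite mule_ge0 ?lee_fin.
- by move=> x _ a b ab; rewrite lee_wpmul2l ?lee_fin//; exact/lefP/nd_nnsfun_approx.
Qed.

End weighted_law.

(** The product of the entrywise indicators is the indicator of an orthant, so the hypothesis says
    that the two weighted laws agree on a generating pi-system. *)
Lemma eq_wlaw_box {R : realType} {d1 d2 : measure_display} {T1 : measurableType d1}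
    {T2 : measurableType d2} {m n : nat}
    (m1 : {measure set T1 -> \bar R}) (m2 : {measure set T2 -> \bar R})
    (g1 : T1 -> R) (g2 : T2 -> R)
    (X1 : T1 -> 'M[R]_(m, n)) (X2 : T2 -> 'M[R]_(m, n)) :
  (forall x, 0 <= g1 x) -> (forall x, 0 <= g2 x) ->
  m1.-integrable setT (EFin \o g1) -> m2.-integrable setT (EFin \o g2) ->
  measurable_fun setT X1 -> measurable_fun setT X2 ->
  (forall b : 'I_m * 'I_n -> R,
    (\int[m1]_x (g1 x * \prod_k (X1 x k.1 k.2 <= b k)%R%:R)%:E =
     \int[m2]_x (g2 x * \prod_k (X2 x k.1 k.2 <= b k)%R%:R)%:E)%E) ->
  forall f : 'M[R]_(m, n) -> \bar R, measurable_fun setT f -> (forall y, 0 <= f y)%E ->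
  (\int[m1]_x ((g1 x)%:E * f (X1 x)) = \int[m2]_x ((g2 x)%:E * f (X2 x)))%E.
Proof.
move=> g10 g20 ig1 ig2 mX1 mX2 h f mf f0.
rewrite -!integral_wlaw//.
apply: eq_measure_integral => A mA _.
apply: eq_measure_mx_box => // [|a].
  rewrite /= /wlaw preimage_setT.
  have /integrableP[_] := ig1; apply: le_lt_trans; apply: ge0_le_integral => //.
  - by move=> x _; rewrite lee_fin.
  - by apply: measurable_int ig1.
  - by apply/measurable_EFinP; apply: measurableT_comp => //; exact/measurable_EFinP/(measurable_int m1).
  - by move=> x _ /=; rewrite lee_fin ler_norm.
have E d (T : measurableType d) (mu : {measure set T -> \bar R}) (g : T -> R)
    (X : T -> 'M[R]_(m, n)) :
    (\int[mu]_(x in X @^-1` mx_box a) (g x)%:E =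
     \int[mu]_x (g x * \prod_k (X x k.1 k.2 <= a k.1 k.2)%R%:R)%:E)%E.
  rewrite integral_mkcond; apply: eq_integral => x _; rewrite patchE.
  case: ifPn; rewrite ?inE ?notin_setE/= => h1.
    by rewrite big1 ?mulr1// => k _; rewrite h1.
  have /existsP[k hk] : [exists k : 'I_m * 'I_n, ~~ (X x k.1 k.2 <= a k.1 k.2)].
    apply: contra_notT h1 => /existsPn hn i j.
    by have := hn (i, j); rewrite negbK.
  by rewrite (bigD1 k)//= (negbTE hk) mul0r mulr0.
by rewrite /= /wlaw !E; exact: (h (fun k => a k.1 k.2)).
Qed.

(** * Laplace transforms in several variables *)

Section laplace_multi.
Context {R : realType} {d1 d2 : measure_display}
  {T1 : measurableType d1} {T2 : measurableType d2}.
Variables (m1 : {measure set T1 -> \bar R}) (m2 : {measure set T2 -> \bar R}).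
Variables (I : eqType) (u1 : I -> T1 -> R) (u2 : I -> T2 -> R).
Hypotheses (mu1 : forall i, measurable_fun setT (u1 i))
  (mu2 : forall i, measurable_fun setT (u2 i))
  (u10 : forall i x, 0 <= u1 i x) (u20 : forall i x, 0 <= u2 i x).

Lemma measurable_prod_expRN d (T : measurableType d) (u : I -> T -> R) (t : I -> R) s :
  (forall i, measurable_fun setT (u i)) ->
  measurable_fun setT (fun x => \prod_(i <- s) expR (- (t i * u i x))).
Proof. by move=> mu; apply: measurable_prod => i _; exact: measurable_expRN. Qed.

Lemma norm_prod_expRN d (T : measurableType d) (u : I -> T -> R) (t : I -> R) s x :
  (forall i x, 0 <= u i x) -> (forall i, 0 <= t i) ->
  `|\prod_(i <- s) expR (- (t i * u i x))| <= 1.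
Proof.
move=> u0 t0; apply: (big_ind (fun y : R => `|y| <= 1)) => [|y z y1 z1|i _].
- by rewrite normr1.
- by rewrite normrM mulr_ile1.
- exact: norm_expRN_le1.
Qed.

(** One variable at a time: the exponentials of the other variables are absorbed into the weight
    while [eq_laplace_le] treats the first, and the resulting indicator is absorbed into the weight
    for the induction hypothesis. This is why the weights are general. *)
Lemma eq_laplace_multi (s : seq I) (g1 : T1 -> R) (g2 : T2 -> R) : uniq s ->
  m1.-integrable setT (EFin \o g1) -> m2.-integrable setT (EFin \o g2) ->
  (forall t : I -> R, (forall i, 0 <= t i) ->
    (\int[m1]_x (g1 x * \prod_(i <- s) expR (- (t i * u1 i x)))%:E =
     \int[m2]_x (g2 x * \prod_(i <- s) expR (- (t i * u2 i x)))%:E)%E) ->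
  forall a : I -> R,
  (\int[m1]_x (g1 x * \prod_(i <- s) (u1 i x <= a i)%R%:R)%:E =
   \int[m2]_x (g2 x * \prod_(i <- s) (u2 i x <= a i)%R%:R)%:E)%E.
Proof.
elim: s g1 g2 => [|i s IH] g1 g2.
  move=> _ _ _ h a; have := h (fun=> 0) (fun=> lexx _).
  under eq_integral do rewrite big_nil.
  under [in X in _ = X -> _]eq_integral do rewrite big_nil.
  under [in X in _ -> X = _]eq_integral do rewrite big_nil.
  by under [in X in _ -> _ = X]eq_integral do rewrite big_nil.
move=> /= /andP[nis us] ig1 ig2 h a.
have step t : (forall i, 0 <= t i) ->
  (\int[m1]_x ((g1 x * \prod_(j <- s) expR (- (t j * u1 j x))) * (u1 i x <= a i)%R%:R)%:E =
   \int[m2]_x ((g2 x * \prod_(j <- s) expR (- (t j * u2 j x))) * (u2 i x <= a i)%R%:R)%:E)%E.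
  move=> t0; apply: eq_laplace_le => //.
  - apply: (integrable_mulr_bounded ig1 (measurable_prod_expRN _ _ mu1)) => x.
    exact: norm_prod_expRN.
  - apply: (integrable_mulr_bounded ig2 (measurable_prod_expRN _ _ mu2)) => x.
    exact: norm_prod_expRN.
  (* The parameter of the first variable is set to r and the others are kept; this is consistent
     because i does not occur in s. *)
  move=> r r0; pose t' j := if j == i then r else t j.
  have t'0 j : 0 <= t' j by rewrite /t'; case: ifP.
  have e d (T : measurableType d) (u : I -> T -> R) (g : T -> R) x :
      (g x * \prod_(j <- s) expR (- (t j * u j x))) * expR (- (r * u i x)) =
      g x * \prod_(j <- i :: s) expR (- (t' j * u j x)).
    rewrite big_cons {1}/t' eqxx [in RHS]mulrCA mulrC; congr (_ * (_ * _)).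
    by apply: eq_big_seq => j js; rewrite /t'; case: eqP => // ji; rewrite -ji js in nis.
  under eq_integral do rewrite e.
  by under [in RHS]eq_integral do rewrite e; exact: h.
have meas_ind d (T : measurableType d) (u : T -> R) (b : R) : measurable_fun setT u ->
    measurable_fun setT (fun x => (u x <= b)%R%:R : R).
  move=> mu; have -> : (fun x => (u x <= b)%R%:R : R) =
      (fun x => if u x <= b then 1 else 0) by apply/funext => x; case: ifP.
  by apply: measurable_fun_ifT => //; exact: measurable_fun_ler.
have := IH (fun x => g1 x * (u1 i x <= a i)%R%:R) (fun x => g2 x * (u2 i x <= a i)%R%:R) us.
have i1 : m1.-integrable setT (EFin \o (fun x => g1 x * (u1 i x <= a i)%R%:R)).
  apply: (@integrable_mulr_bounded _ _ _ m1 _ _ 1 ig1); first exact: meas_ind.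
  by move=> x; rewrite ger0_norm// lern1 leq_b1.
have i2 : m2.-integrable setT (EFin \o (fun x => g2 x * (u2 i x <= a i)%R%:R)).
  apply: (@integrable_mulr_bounded _ _ _ m2 _ _ 1 ig2); first exact: meas_ind.
  by move=> x; rewrite ger0_norm// lern1 leq_b1.
move=> /(_ i1 i2) IH'; have := IH' _ a => {IH'} IH'.
under eq_integral do rewrite big_cons mulrA.
under [in RHS]eq_integral do rewrite big_cons mulrA.
apply: IH' => t t0; under eq_integral do rewrite mulrAC.
by under [in RHS]eq_integral do rewrite mulrAC; exact: step.
Qed.

End laplace_multi.

(** * Bounded functions on a product of probability spaces *)

Section product_probability.
Context {R : realType} {d1 d2 : measure_display}
  {T1 : measurableType d1} {T2 : measurableType d2}.
Variables (P1 : probability T1 R) (P2 : probability T2 R).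

Lemma prod_bounded_integrable (h : T1 * T2 -> R) (C : R) :
  measurable_fun setT h -> (forall x, `|h x| <= C) ->
  (P1 \x P2)%E.-integrable setT (EFin \o h).
Proof.
move=> mh hC; apply: bounded_integrable mh hC.
have : ((P1 \x P2)%E (setT `*` setT) < +oo)%E.
  rewrite product_measure1E//; apply: (@le_lt_trans _ _ (1 * 1)%E).
    by apply: lee_pmul => //; exact: probability_le1.
  by rewrite mul1e ltry.
by rewrite setXTT.
Qed.

Lemma bounded_Fubini (h : T1 * T2 -> R) (C : R) :
  measurable_fun setT h -> (forall x, `|h x| <= C) ->
  (\int[P1]_x \int[P2]_y (h (x, y))%:E = \int[P2]_y \int[P1]_x (h (x, y))%:E)%E.
Proof.
by move=> mh hC; apply: (@Fubini _ _ _ _ _ P1 P2 (EFin \o h)); exact: prod_bounded_integrable mh hC.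
Qed.
End product_probability.

(** * From characteristic functions to laws *)

Section charfn_unique.
Context {R : realType}.

(** The Frobenius inner product, which pairs a random matrix with its dual variable. *)
Definition mxdot {m n} (A M : 'M[R]_(m, n)) : R := \tr (A^T *m M).

Lemma mxdot_delta m n i j (M : 'M[R]_(m, n)) : mxdot (delta_mx i j) M = M i j.
Proof.
rewrite /mxdot trmx_delta /mxtrace (bigD1 j)//= big1 => [|k kj].
  rewrite addr0 mxE (bigD1 i)//= big1 => [|l li].
    by rewrite addr0 !mxE !eqxx mul1r.
  by rewrite !mxE eqxx (negbTE li) mul0r.
by rewrite mxE big1// => l _; rewrite !mxE (negbTE kj) mul0r.
Qed.

Lemma mxdotDl m n (A B M : 'M[R]_(m, n)) : mxdot (A + B) M = mxdot A M + mxdot B M.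
Proof. by rewrite /mxdot linearD/= mulmxDl mxtraceD. Qed.

Lemma mxdotZl m n a (A M : 'M[R]_(m, n)) : mxdot (a *: A) M = a * mxdot A M.
Proof. by rewrite /mxdot linearZ/= -scalemxAl mxtraceZ. Qed.

Lemma mxdot0l m n (M : 'M[R]_(m, n)) : mxdot 0 M = 0.
Proof. by rewrite /mxdot trmx0 mul0mx mxtrace0. Qed.

Lemma measurable_mxdot d (T : measurableType d) m n (A : 'M[R]_(m, n))
  (X : T -> 'M[R]_(m, n)) : measurable_fun setT X ->
  measurable_fun setT (fun x => mxdot A (X x)).
Proof.
move=> /measurable_mxP mX; rewrite /mxdot /mxtrace.
apply: measurable_sum => i; under eq_fun do rewrite mxE.
by apply: measurable_sum => j; apply: measurable_funM => //; exact: mX.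
Qed.

(* [exp (- t z^2)] is the characteristic function of a normal variable at [sqrt (2 t) z]. *)
Lemma gauss_smoothing d (T : measurableType d) (P : probability T R)
    (G z th : T -> R) (t : R) : 0 <= t -> measurable_fun setT G ->
  (forall x, `|G x| <= 1) -> measurable_fun setT z -> measurable_fun setT th ->
  (\int[P]_x (G x * expR (- (t * z x ^+ 2)) * cos (th x))%:E =
   \int[normal_prob 0 1]_y \int[P]_x (G x * cos (Num.sqrt (2 * t) * z x * y + th x))%:E)%E.
Proof.
move=> t0 mG G1 mz mth.
rewrite -(@bounded_Fubini _ _ _ _ _ P (normal_prob 0 1)
  (fun p => G p.1 * cos (Num.sqrt (2 * t) * z p.1 * p.2 + th p.1)) 1).
- apply: eq_integral => x _ /=.
  under eq_integral do rewrite EFinM.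
  rewrite integralZl//; last first.
    apply: (@prob_bounded_integrable _ _ _ (normal_prob 0 1) _ 1) => [|y].
      exact: (@measurable_cos_affine _ _ _ id).
    exact: norm_cos_le1.
  rewrite normal_charfn ?oner_neq0// -EFinM; congr EFin; rewrite -mulrA mulr1.
  by rewrite exprMn sqr_sqrtr ?mulr_ge0//; congr (_ * (expR _ * _)); field.
- apply: measurable_funM; first exact: measurableT_comp.
  apply: (measurableT_comp (continuous_measurable_fun (@continuous_cos R))).
  apply: measurable_funD; last exact: measurableT_comp.
  apply: measurable_funM => //; apply: measurable_funM => //.
  exact: measurableT_comp.
- by move=> p; rewrite normrM mulr_ile1 ?norm_cos_le1.
Qed.

Context {d1 d2 : measure_display} {T1 : measurableType d1} {T2 : measurableType d2}.
Variables (P1 : probability T1 R) (P2 : probability T2 R) (m n : nat).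
Variables (X1 : T1 -> 'M[R]_(m, n)) (X2 : T2 -> 'M[R]_(m, n)).
Hypotheses (mX1 : measurable_fun setT X1) (mX2 : measurable_fun setT X2).
Hypothesis charfn : forall A c,
  (\int[P1]_x (cos (mxdot A (X1 x) + c))%:E = \int[P2]_x (cos (mxdot A (X2 x) + c))%:E)%E.

Local Notation I := ('I_m * 'I_n)%type.
Local Notation "X _[ k ]" := (X k.1 k.2) (at level 10).

Let sqd d (T : measurableType d) (X : T -> 'M[R]_(m, n)) (y : I -> R) (k : I) x :=
  (X x k.1 k.2 - y k) ^+ 2.

Let msqd d (T : measurableType d) (X : T -> 'M[R]_(m, n)) y k : measurable_fun setT X ->
  measurable_fun setT (sqd X y k).
Proof.
by move=> /measurable_mxP mX; apply: measurable_funX; apply: measurable_funB => //; exact: mX.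
Qed.

(** By [gauss_smoothing], each Gaussian factor is an average over z of shifts of the cosine by
    [sqrt (2 t) z (X_k - y_k)]. Such a shift only changes [A] by a multiple of a unit matrix and [c]
    by a constant, so the induction hypothesis applies for each z. *)
Let eq_gauss_charfn (t y : I -> R) (s : seq I) A c : (forall i, 0 <= t i) ->
  (\int[P1]_x (\prod_(k <- s) expR (- (t k * sqd X1 y k x)) * cos (mxdot A (X1 x) + c))%:E =
   \int[P2]_x (\prod_(k <- s) expR (- (t k * sqd X2 y k x)) * cos (mxdot A (X2 x) + c))%:E)%E.
Proof.
move=> t0; elim: s A c => [|k s IH] A c.
  under eq_integral do rewrite big_nil mul1r.
  by under [in RHS]eq_integral do rewrite big_nil mul1r; exact: charfn.
have main d (T : measurableType d) (P : probability T R) (X : T -> 'M[R]_(m, n)) :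
  measurable_fun setT X ->
  (\int[P]_x (\prod_(k <- k :: s) expR (- (t k * sqd X y k x)) * cos (mxdot A (X x) + c))%:E =
   \int[normal_prob 0 1]_z \int[P]_x (\prod_(k <- s) expR (- (t k * sqd X y k x)) *
      cos (mxdot (A + (Num.sqrt (2 * t k) * z) *: delta_mx k.1 k.2) (X x) +
        (c - Num.sqrt (2 * t k) * z * y k)))%:E)%E.
  move=> mX; under eq_integral do rewrite big_cons [expR _ * _]mulrC.
  rewrite gauss_smoothing//.
  - apply: eq_integral => z _; apply: eq_integral => x _.
    congr (_ * cos _)%:E; rewrite mxdotDl mxdotZl mxdot_delta; ring.
  - by apply: measurable_prod_expRN => i; exact: msqd.
  - by move=> x; apply: norm_prod_expRN => // i z; exact: sqr_ge0.
  - by apply: measurable_funB => //; move/measurable_mxP : mX; apply.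
  - by apply: measurable_funD => //; exact: measurable_mxdot.
by rewrite !main//; apply: eq_integral => z _; exact: IH.
Qed.

Let eq_sqd_le (y a : I -> R) (s : seq I) : uniq s ->
  (\int[P1]_x (\prod_(k <- s) (sqd X1 y k x <= a k)%R%:R)%:E =
   \int[P2]_x (\prod_(k <- s) (sqd X2 y k x <= a k)%R%:R)%:E)%E.
Proof.
move=> us; have := @eq_laplace_multi _ _ _ _ _ P1 P2 I (sqd X1 y) (sqd X2 y)
   (fun k => msqd y k mX1) (fun k => msqd y k mX2)
   (fun _ _ => sqr_ge0 _) (fun _ _ => sqr_ge0 _) s (cst 1) (cst 1) us.
have c1 d (T : measurableType d) (P : probability T R) : P.-integrable setT (EFin \o cst (1:R)).
  by apply: (@prob_bounded_integrable _ _ _ P _ 1) => // x; rewrite normr1.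
move=> /(_ (c1 _ _ _) (c1 _ _ _)) h.
under eq_integral do rewrite -[X in X%:E]mul1r.
under [in RHS]eq_integral do rewrite -[X in X%:E]mul1r.
apply: h => t t0; have := eq_gauss_charfn y s 0 0 t0.
have E d (T : measurableType d) (P : probability T R) (X : T -> 'M[R]_(m, n)) :
    (\int[P]_x (\prod_(k <- s) expR (- (t k * sqd X y k x)) * cos (mxdot 0 (X x) + 0))%:E =
     \int[P]_x (cst 1 x * \prod_(k <- s) expR (- (t k * sqd X y k x)))%:E)%E.
  by apply: eq_integral => x _; rewrite mxdot0l addr0 cos0 mulrC.
by rewrite !E.
Qed.

(* The characteristic function determines the Laplace transforms of the squares [(X i j - y i j)^2],
   hence the probabilities of boxes. *)
Lemma charfn_law_unique (f : 'M[R]_(m, n) -> \bar R) :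
  measurable_fun setT f -> (forall y, 0 <= f y)%E ->
  (\int[P1]_x f (X1 x) = \int[P2]_x f (X2 x))%E.
Proof.
move=> mf f0.
have c1 d (T : measurableType d) (P : probability T R) : P.-integrable setT (EFin \o cst (1:R)).
  by apply: (@prob_bounded_integrable _ _ _ P _ 1) => // x; rewrite normr1.
suff : (\int[P1]_x ((cst 1%R x)%:E * f (X1 x)) = \int[P2]_x ((cst 1%R x)%:E * f (X2 x)))%E.
  under eq_integral do rewrite mul1e.
  by under [X in _ = X -> _]eq_integral do rewrite mul1e.
apply: eq_wlaw_box => //; [exact: c1|exact: c1|move=> b].
(* The condition [(X - y)^2 <= N^2] describes the interval [b - 2N, b], which increases to the
   half-line below b. *)
pose y k N : R := b k - N%:R.
have main d (T : measurableType d) (P : probability T R) (X : T -> 'M[R]_(m, n)) :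
    measurable_fun setT X ->
    [/\ forall N, measurable_fun setT
          (fun x => \prod_(k <- index_enum I) (sqd X (y ^~ N) k x <= N%:R ^+ 2)%R%:R : R),
     forall N x, `|\prod_(k <- index_enum I) (sqd X (y ^~ N) k x <= N%:R ^+ 2)%R%:R : R| <= cst 1 x &
     forall x, (\prod_(k <- index_enum I) (sqd X (y ^~ N) k x <= N%:R ^+ 2)%R%:R : R) @[N --> \oo]
        --> (cst 1 x * \prod_k (X x k.1 k.2 <= b k)%R%:R : R)].
  move=> mX; split.
  - move=> N; apply: measurable_prod => k _.
    rewrite (_ : (fun x => _) = (fun x => if sqd X (y ^~ N) k x <= N%:R ^+ 2 then 1 else 0)).
      by apply: measurable_fun_ifT => //; apply: measurable_fun_ler => //; exact: msqd.
    by apply/funext => x; case: ifP.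
  - move=> N x; apply: (big_ind (fun z : R => `|z| <= 1)) => [|u v u1 v1|k _].
    + by rewrite normr1.
    + by rewrite normrM mulr_ile1.
    + by rewrite ger0_norm// lern1 leq_b1.
  - move=> x; apply: cvg_near_cst; near=> N; rewrite mul1r.
    apply: eq_bigr => k _; congr (_%:R); congr nat_of_bool.
    have : \sum_k `|X x k.1 k.2 - b k| <= N%:R.
      by near: N; exact: nbhs_infty_ger.
    rewrite (bigD1 k)//=; set r := \sum_(_ | _) _ => hN.
    have r0 : 0 <= r by exact: sumr_ge0.
    have hk : `|X x k.1 k.2 - b k| <= N%:R by lra.
    move: hk; rewrite ler_norml => /andP[hk1 hk2].
    rewrite /sqd /y opprB addrA addrAC.
    by rewrite ler_sqr ?nnegrE// ?gerDr ?subr_le0// -lerBlDr sub0r.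
have [a1 b1 e1] := main _ _ P1 _ mX1.
have [a2 b2 e2] := main _ _ P2 _ mX2.
apply: (eq_integral_dominated a1 a2 (c1 _ _ _) (c1 _ _ _) b1 b2 e1 e2) => N.
by apply: eq_sqd_le; exact: index_enum_uniq.
Unshelve. all: by end_near. Qed.

End charfn_unique.

(** * Measurability of the Cholesky factor *)

Section measurable_matrix.
Context {R : realType} {d : measure_display} {T : measurableType d}.

Lemma measurable_forall_fin (I : finType) (D : I -> set T) :
  (forall i, measurable (D i)) -> measurable [set x | forall i, D i x].
Proof.
move=> mD; rewrite (_ : mkset _ = \bigcap_(i in [set: I]) D i).
  by apply: fin_bigcap_measurable => //; exact: finite_finset.
by apply/seteqP; split => [x h i _|x h i]; exact: h.
Qed.

Lemma measurable_invr : measurable_fun setT (fun x : R => x^-1).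
Proof.
have -> : (fun x : R => x^-1) = (fun x => if x == 0 then 0 else x^-1).
  by apply/funext => x; case: eqP => // ->; rewrite invr0.
apply: measurable_fun_if => //; first exact: measurable_fun_eqr.
rewrite setTI (_ : _ @^-1` _ = [set x : R | x != 0]); last first.
  by apply/seteqP; split => x /=; case: eqP.
apply: open_continuous_measurable_fun; first exact: open_neq.
by move=> x; rewrite inE/= => x0; exact: inv_continuous.
Qed.

Lemma measurable_funV (f : T -> R) : measurable_fun setT f ->
  measurable_fun setT (fun x => (f x)^-1).
Proof. by move=> mf; exact: (measurableT_comp measurable_invr). Qed.

Lemma measurable_sqrtr (f : T -> R) : measurable_fun setT f ->
  measurable_fun setT (fun x => Num.sqrt (f x)).
Proof.
by move=> mf; exact: (measurableT_comp (continuous_measurable_fun (@sqrt_continuous R))).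
Qed.

Lemma measurable_mulmx m n p (X : T -> 'M[R]_(m, n)) (Y : T -> 'M[R]_(n, p)) :
  measurable_fun setT X -> measurable_fun setT Y ->
  measurable_fun setT (fun x => X x *m Y x).
Proof.
move=> /measurable_mxP mX /measurable_mxP mY; apply/measurable_mxP => i j.
under eq_fun do rewrite mxE; apply: measurable_sum => k.
by apply: measurable_funM; [exact: mX|exact: mY].
Qed.

Lemma measurable_trmx m n (X : T -> 'M[R]_(m, n)) :
  measurable_fun setT X -> measurable_fun setT (fun x => (X x)^T).
Proof.
move=> /measurable_mxP mX; apply/measurable_mxP => i j.
by under eq_fun do rewrite mxE; exact: mX.
Qed.

Lemma measurable_det n (X : T -> 'M[R]_n) : measurable_fun setT X ->
  measurable_fun setT (fun x => \det (X x)).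
Proof.
move=> /measurable_mxP mX; rewrite /determinant; apply: measurable_sum => s.
by apply: measurable_funM => //; apply: measurable_prod => i _; exact: mX.
Qed.

Lemma measurable_if_set (D : set T) d' (V' : measurableType d') (f g : T -> V') :
  measurable D -> measurable_fun setT f -> measurable_fun setT g ->
  measurable_fun setT (fun x => if x \in D then f x else g x).
Proof.
move=> mD mf mg; apply: measurable_fun_ifT => //.
apply: (measurable_fun_bool true) => //.
rewrite setTI (_ : _ @^-1` _ = D)//; apply/seteqP.
by split => x /=; [exact: set_mem|exact: mem_set].
Qed.

Lemma measurable_invmx n (X : T -> 'M[R]_n) : measurable_fun setT X ->
  measurable_fun setT (fun x => invmx (X x)).
Proof.
move=> mX; have mdet := measurable_det mX.
have -> : (fun x => invmx (X x)) = (fun x => if \det (X x) == 0 then X x else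
    (\det (X x))^-1 *: \adj (X x)).
  by apply/funext => x; rewrite /invmx unitmxE unitfE; case: eqP.
apply: measurable_fun_ifT => //; first exact: measurable_fun_eqr.
apply/measurable_mxP => i j; under eq_fun do rewrite !mxE.
apply: measurable_funM; first exact: measurable_funV.
apply: measurable_funM => //; apply: measurable_det; apply/measurable_mxP => k l.
by under eq_fun do rewrite !mxE; move/measurable_mxP : mX; exact.
Qed.

End measurable_matrix.

Section cholesky.
Context {R : realType}.

(** Cholesky elimination through Schur complements. [chol] is defined by choice, so its
    measurability has to be read off an explicit formula. Square root and inverse are total, hence
    so is this function. *)
Fixpoint cholf n : 'M[R]_n -> 'M[R]_n :=
  match n return 'M[R]_n -> 'M[R]_n with
  | 0 => id
  | n'.+1 => fun A : 'M[R]_(1 + n') =>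
      let a := ulsubmx A 0 0 in
      block_mx (Num.sqrt a)%:M 0 ((Num.sqrt a)^-1 *: dlsubmx A)
        (cholf (drsubmx A - a^-1 *: (dlsubmx A *m (dlsubmx A)^T)))
  end.

(** Read blockwise, L L^T = A forces the first column of L, and the remaining block of L is a
    Cholesky factor of the Schur complement. *)
Lemma chol_spec_cholf n (A L : 'M[R]_n) : chol_spec A L -> L = cholf A.
Proof.
elim: n A L => [|n IH] A L; first by rewrite !flatmx0.
rewrite -[n.+1]/(1 + n)%N in A L *; move=> [Lu Ld LA].
pose l := ulsubmx L 0 0; pose m := dlsubmx L; pose L' := drsubmx L.
have l0 : 0 < l by rewrite /l !mxE; exact: Ld.
have LE : L = block_mx l%:M 0 m L'.
  rewrite -[L]submxK /l -mx11_scalar; congr block_mx.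
  by apply/matrixP => i j; rewrite !mxE Lu//= ord1 /=.
have AE : A = block_mx (l ^+ 2)%:M (l *: m^T) (l *: m) (m *m m^T + L' *m L'^T).
  rewrite -LA LE tr_block_mx mulmx_block !tr_scalar_mx !trmx0 !mul0mx !mulmx0 !addr0.
  rewrite -scalar_mxM expr2 mul_scalar_mx; congr block_mx.
  by rewrite mul_mx_scalar.
have a2 : ulsubmx A 0 0 = l ^+ 2 by rewrite AE block_mxKul mxE eqxx.
have dlA : dlsubmx A = l *: m by rewrite AE block_mxKdl.
have drA : drsubmx A = m *m m^T + L' *m L'^T by rewrite AE block_mxKdr.
rewrite /= a2 dlA drA sqrtr_sqr gtr0_norm// scalerA mulVf ?gt_eqF// scale1r.
have -> : l ^- 2 *: (l *: m *m (l *: m)^T) = m *m m^T.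
  rewrite [(l *: m)^T]linearZ/= -scalemxAr -scalemxAl !scalerA -expr2.
  by rewrite mulVf ?scale1r// expf_eq0 gt_eqF.
rewrite [_ + L' *m _]addrC addrK -(IH _ L')//.
split=> // [i j ij|i].
- by rewrite /L' !mxE Lu//= !/bump/=.
- by rewrite /L' !mxE; exact: Ld.
Qed.

(** The recursion goes through because the Schur complement of a positive definite matrix is
    positive definite. *)
Lemma cholfP n (A : 'M[R]_n) : posdef A -> chol_spec A (cholf A).
Proof.
elim: n A => [|n IH] A; first by move=> _; split=> [[]|[]|]//; rewrite !flatmx0.
rewrite -[n.+1]/(1 + n)%N in A *; move=> [As Ap].
pose a := ulsubmx A 0 0; pose b := dlsubmx A; pose C := drsubmx A.
have urA : ursubmx A = b^T by rewrite /b trmx_dlsub As.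
have AE : A = block_mx a%:M b^T b C by rewrite -[LHS]submxK urA /a -mx11_scalar.
have CT : C^T = C by rewrite /C trmx_drsub As.
have a0 : 0 < a.
  have := Ap (col_mx 1%:M 0); rewrite AE tr_col_mx mul_row_block.
  rewrite !tr_scalar_mx !trmx0 !mul0mx !addr0 !mul1mx mul_row_col mulmx0 addr0 mulmx1.
  rewrite mxE eqxx mulr1n; apply; apply/eqP => /matrixP /(_ 0 0).
  rewrite (_ : 0 = lshift n 0 :> 'I_(1 + n)); last exact/val_inj.
  by rewrite col_mxEu !mxE eqxx => /eqP; rewrite oner_eq0.
pose S := C - a^-1 *: (b *m b^T).
have Spd : posdef S.
  split=> [|y y0].
    by rewrite /S linearB/= linearZ/= trmx_mul trmxK CT.
  (* The first coordinate is chosen so that the first coordinate of A x vanishes; the quadratic form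
     of A at x is then that of the Schur complement at y. *)
  pose x : 'cV[R]_(1 + n) := col_mx (- a^-1 *: (b^T *m y)) y.
  have x0 : x != 0.
    apply: contra_neq y0 => /(congr1 dsubmx); rewrite col_mxKd => ->.
    by apply/matrixP => i j; rewrite !mxE.
  have := Ap x x0; rewrite -mulmxA AE mul_block_col -scalemxAr mul_scalar_mx.
  rewrite scalerA mulNr mulVf ?gt_eqF// scaleN1r addNr tr_col_mx mul_row_col mulmx0 add0r.
  rewrite -mulmxA; congr (0 < (_ *m _) 0 0).
  by rewrite /S mulmxBl -scalemxAl -scalemxAr scaleNr addrC mulmxA.
have [Lu Ld LS] := IH S Spd; split.
- move=> i j ij; rewrite /= -/a -/b -/C -/S.
  case: (split_ordP i) ij => i' -> ij; case: (split_ordP j) ij => j' -> ij.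
  + by rewrite !ord1 ltnn in ij.
  + by rewrite block_mxEur mxE.
  + by move: ij; rewrite /= ord1.
  + by rewrite block_mxEdr Lu// -(ltn_add2l 1).
- move=> i; rewrite /= -/a -/b -/C -/S; case: (split_ordP i) => i' ->.
  + by rewrite block_mxEul mxE !ord1 eqxx sqrtr_gt0.
  + by rewrite block_mxEdr.
- rewrite /= -/a -/b -/C -/S tr_block_mx mulmx_block !tr_scalar_mx !trmx0.
  rewrite !mul0mx !mulmx0 !addr0 LS -scalar_mxM -expr2 sqr_sqrtr ?(ltW a0)//.
  rewrite linearZ/= mul_scalar_mx mul_mx_scalar !scalerA.
  have sa : Num.sqrt a != 0 by rewrite gt_eqF// sqrtr_gt0.
  rewrite mulfV// !scale1r -scalemxAr -scalemxAl scalerA -invfM -expr2.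
  by rewrite sqr_sqrtr ?(ltW a0)// [_ + S]addrC /S subrK -AE.
Qed.

(** Where no factor exists both sides are the default 0, so the choice operator becomes a case
    distinction on an explicit set. *)
Lemma cholE n (A : 'M[R]_n) : chol A =
  if A \in [set A | chol_spec A (cholf A)] then cholf A else 0.
Proof.
case: ifPn; rewrite ?inE ?notin_setE/= => h.
  by rewrite /chol; exact/chol_spec_cholf/(xgetPex 0 (ex_intro _ _ h)).
rewrite /chol; case: xgetP => // L _ hL; exfalso; apply: h.
by rewrite -(chol_spec_cholf hL).
Qed.

Lemma chol_posdef n (A : 'M[R]_n) : posdef A -> chol_spec A (chol A).
Proof. by move=> pA; rewrite cholE mem_set; exact: cholfP. Qed.

Lemma measurable_cholf d (T : measurableType d) n (X : T -> 'M[R]_n) :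
  measurable_fun setT X -> measurable_fun setT (fun x => cholf (X x)).
Proof.
elim: n X => [|n IH] X mX; first by rewrite /=.
rewrite -[n.+1]/(1 + n)%N in X mX *.
have mXe i j : measurable_fun setT (fun x => X x i j) by move/measurable_mxP : mX; exact.
have ma : measurable_fun setT (fun x => ulsubmx (X x) 0 0).
  by under eq_fun do rewrite !mxE; exact: mXe.
have mb : measurable_fun setT (fun x => dlsubmx (X x)).
  by apply/measurable_mxP => i j; under eq_fun do rewrite !mxE; exact: mXe.
have mS := IH (fun x => drsubmx (X x) -
  (ulsubmx (X x) 0 0)^-1 *: (dlsubmx (X x) *m (dlsubmx (X x))^T)).
have {}mS : measurable_fun setT (fun x => cholf (drsubmx (X x) -
  (ulsubmx (X x) 0 0)^-1 *: (dlsubmx (X x) *m (dlsubmx (X x))^T))).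
  apply: mS; apply/measurable_mxP => i j.
  have /measurable_mxP mbb := measurable_mulmx mb (measurable_trmx mb).
  have gen (M N : 'M[R]_n) c : (M - c *: N) i j = M i j - c * N i j by rewrite !mxE.
  under eq_fun do rewrite gen.
  apply: measurable_funB; first by under eq_fun do rewrite !mxE; exact: mXe.
  by apply: measurable_funM; [exact: measurable_funV|exact: mbb].
apply/measurable_mxP => i j /=.
case: (split_ordP i) => i' ->; case: (split_ordP j) => j' ->.
- rewrite (ord1 i') (ord1 j'); under eq_fun do rewrite block_mxEul mxE eqxx mulr1n.
  exact: measurable_sqrtr.
- by under eq_fun do rewrite block_mxEur mxE; exact: measurable_cst.
- under eq_fun do rewrite block_mxEdl mxE; apply: measurable_funM.
    by apply: measurable_funV; exact: measurable_sqrtr.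
  by move/measurable_mxP : mb; exact.
- under eq_fun do rewrite block_mxEdr.
  by move/measurable_mxP : mS; exact.
Qed.

Lemma measurable_chol n : measurable_fun setT (@chol R n).
Proof.
have -> : @chol R n = fun A => if A \in [set A | chol_spec A (cholf A)] then cholf A else 0.
  by apply/funext => A; exact: cholE.
have mc : measurable_fun setT (fun A : 'M[R]_n => cholf A) by exact: measurable_cholf.
have /measurable_mxP mce := mc.
have /measurable_mxP mLL := measurable_mulmx mc (measurable_trmx mc).
have mset (f g : 'M[R]_n -> R) : measurable_fun setT f -> measurable_fun setT g ->
    measurable [set A | f A = g A].
  move=> mf mg; have := measurable_fun_eqr mf mg => /(_ measurableT [set true]).
  rewrite setTI (_ : _ @^-1` _ = [set A | f A = g A]); first by apply.
  by apply/seteqP; split => A /= /eqP.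
apply: measurable_if_set => //.
(* The case distinction is measurable since its set is cut out by finitely many equations and strict
   inequalities between measurable functions of A. *)
rewrite (_ : mkset _ = [set A | forall p : 'I_n * 'I_n, (p.1 < p.2)%N -> cholf A p.1 p.2 = 0]
  `&` [set A | forall i : 'I_n, 0 < cholf A i i] `&`
  [set A | forall p : 'I_n * 'I_n, (cholf A *m (cholf A)^T) p.1 p.2 = A p.1 p.2]).
  apply: measurableI; first apply: measurableI.
  - apply: measurable_forall_fin => p.
    case: (boolP (p.1 < p.2)%N) => hp.
      rewrite [X in measurable X](_ : _ = [set A | cholf A p.1 p.2 = 0]).
        by apply: mset => //; exact: mce.
      by apply/seteqP; split => A /= h; [exact: h|move=> _; exact: h].
    by rewrite [X in measurable X](_ : _ = setT)//; apply/seteqP; split => A.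
  - apply: measurable_forall_fin => i.
    have /(_ measurableT [set true] I) := measurable_fun_ltr
      (measurable_cst (0 : R)) (mce i i).
    by rewrite setTI.
  - apply: measurable_forall_fin => p; apply: mset; first exact: mLL.
    exact: measurable_mxentry.
apply/seteqP; split => A /=.
  move=> [h1 h2 h3]; split; last by move=> p; rewrite h3.
  by split=> // p; exact: h1.
move=> [[h1 h2] h3]; split => //; first by move=> i j; exact: (h1 (i, j)).
by apply/matrixP => i j; exact: (h3 (i, j)).
Qed.

End cholesky.

(** * Independent columns *)

Lemma ge0_integral_prodM {R : realType} {d1 d2 : measure_display}
    {T1 : measurableType d1} {T2 : measurableType d2}
    (P1 : probability T1 R) (P2 : probability T2 R) (u : T1 -> R) (v : T2 -> R) :
  measurable_fun setT u -> measurable_fun setT v ->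
  (forall x, 0 <= u x) -> (forall x, 0 <= v x) ->
  (\int[P1 \x P2]_z (u z.1 * v z.2)%:E = \int[P1]_x (u x)%:E * \int[P2]_y (v y)%:E)%E.
Proof.
move=> mu mv u0 v0.
rewrite fubini_tonelli1/=; last 2 first.
- apply/measurable_EFinP; apply: measurable_funM.
    exact: (measurableT_comp mu).
  exact: (measurableT_comp mv).
- by move=> z; rewrite lee_fin mulr_ge0.
transitivity (\int[P1]_x ((u x)%:E * \int[P2]_y (v y)%:E))%E.
  apply: eq_integral => x _; rewrite /fubini_F/=.
  under eq_integral do rewrite EFinM.
  rewrite ge0_integralZl//; first exact/measurable_EFinP.
  - by move=> y _; rewrite lee_fin.
  - by rewrite lee_fin.
rewrite ge0_integralZr//; first exact/measurable_EFinP.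
- by move=> y _; rewrite lee_fin.
- by apply: integral_ge0 => y _; rewrite lee_fin.
Qed.

Section independent_columns.
Context {R : realType} {d0 : measure_display} {Omega : measurableType d0}.
Variables (P : probability Omega R) (d n : nat).
Variable X : 'I_n -> Omega -> 'cV[R]_d.
Hypothesis mX : forall k, measurable_fun setT (fun w => tup_of_cV (X k w)).
Hypothesis indep : mutually_independent P X.

Definition columns (w : Omega) : 'M[R]_(d, n) := \matrix_(i, j) X j w i 0.

Lemma measurable_column k : measurable_fun setT (X k).
Proof.
apply/measurable_mxP => i j; rewrite (ord1 j).
have -> : (fun w => X k w i 0) = (fun w => tnth (tup_of_cV (X k w)) i).
  by apply/funext => w; rewrite tnth_mktuple.
exact: (measurableT_comp (measurable_tnth i) (mX k)).
Qed.

Lemma measurable_columns : measurable_fun setT columns.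
Proof.
apply/measurable_mxP => i j; under eq_fun do rewrite mxE.
by have /measurable_mxP := measurable_column j; exact.
Qed.

(** Independence of the columns is used in one form only: replacing those outside [K] by the columns
    of an independent copy does not change the law. *)
Definition mx_glue (K : pred 'I_n) (M N : 'M[R]_(d, n)) : 'M[R]_(d, n) :=
  \matrix_(i, j) if K j then M i j else N i j.

Let box (b : 'I_d * 'I_n -> R) (j : 'I_n) : set (d.-tuple R) :=
  [set t | forall i, tnth t i <= b (i, j)].

Let mbox b j : measurable (box b j).
Proof.
apply: measurable_forall_fin => i.
rewrite [X in measurable X](_ : _ = (fun t : d.-tuple R => tnth t i) @^-1` `]-oo, b (i, j)]).
  by rewrite -[X in measurable X]setTI; exact: measurable_tnth.
by apply/seteqP; split => t /=; rewrite in_itv.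
Qed.

Let event (B : 'I_n -> set (d.-tuple R)) j : set Omega := [set w | B j (tup_of_cV (X j w))].

Let mevent B j : measurable (B j) -> measurable (event B j).
Proof. by move=> mB; rewrite -[X in measurable X]setTI; exact: mX. Qed.

Let indic_event B j w : \1_(event B j) w = \1_(B j) (tup_of_cV (X j w)) :> R.
Proof. by rewrite !indicE; congr ((nat_of_bool _)%:R); apply/idP/idP; rewrite !inE. Qed.

Let integral_prod_indic (B : 'I_n -> set (d.-tuple R)) : (forall j, measurable (B j)) ->
  (\int[P]_w (\prod_j \1_(event B j) w)%:E = \prod_j P (event B j))%E.
Proof.
move=> mB; rewrite -(indep mB).
have mI : measurable (\bigcap_(k in [set: 'I_n]) event B k).
  by apply: fin_bigcap_measurable => [|j _]; [exact: finite_finset|exact: mevent].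
rewrite -[in RHS](setIT (\bigcap_(k in _) _)) -integral_indic//.
apply: eq_integral => w _; congr EFin; rewrite [in RHS]indicE.
case: (boolP (w \in _)); rewrite ?inE ?notin_setE => h.
  by rewrite big1// => j _; rewrite indicE mem_set//; exact: h.
have /existsP[j hj] : [exists j, w \notin event B j].
  apply: contra_notT h => /existsPn hn j _.
  by have := hn j; rewrite negbK inE.
by rewrite (bigD1 j)//= indicE (negbTE hj) mul0r.
Qed.

Let prod_entries (b : 'I_d * 'I_n -> R) (M : 'I_n -> 'cV[R]_d) :
  \prod_k ((M k.2 k.1 0 <= b k)%R%:R : R) =
  \prod_j \1_(box b j) (tup_of_cV (M j)).
Proof.
have -> : \prod_k ((M k.2 k.1 0 <= b k)%R%:R : R) =
    \prod_j \prod_i ((M j i 0 <= b (i, j))%R%:R : R).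
  rewrite exchange_big/= pair_big/=.
  by apply: eq_bigr => -[].
apply: eq_bigr => j _; rewrite indicE; case: (boolP (_ \in _)).
  rewrite inE => h; rewrite big1// => i _.
  by have := h i; rewrite tnth_mktuple => ->.
rewrite notin_setE => h.
have /existsP[i hi] : [exists i, ~~ (M j i 0 <= b (i, j))].
  apply: contra_notT h => /existsPn hn i; rewrite tnth_mktuple.
  by have := hn i; rewrite negbK.
by rewrite (bigD1 i)//= (negbTE hi) mul0r.
Qed.

Lemma measurable_glue K : measurable_fun setT
  (fun z : Omega * Omega => mx_glue K (columns z.1) (columns z.2)).
Proof.
apply/measurable_mxP => i j; under eq_fun do rewrite mxE.
have /measurable_mxP mc := measurable_columns.
case: (K j); apply: (measurableT_comp (mc i j)) => //.
Qed.

(** On an orthant both sides factor into the same product of probabilities over the columns;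
    [eq_wlaw_box] extends this to all functions. *)
Lemma ge0_resample (K : pred 'I_n) (f : 'M[R]_(d, n) -> \bar R) :
  measurable_fun setT f -> (forall M, 0 <= f M)%E ->
  (\int[P]_w f (columns w) =
   \int[P \x P]_z f (mx_glue K (columns z.1) (columns z.2)))%E.
Proof.
move=> mf f0.
suff : (\int[P]_w ((cst 1%R w)%:E * f (columns w)) =
   \int[P \x P]_z ((cst 1%R z)%:E * f (mx_glue K (columns z.1) (columns z.2))))%E.
  under eq_integral do rewrite mul1e.
  by under [X in _ = X -> _]eq_integral do rewrite mul1e.
apply: eq_wlaw_box => //.
- by apply: (@prob_bounded_integrable _ _ _ P _ 1) => // w; rewrite normr1.
- by apply: (@prod_bounded_integrable _ _ _ _ _ P P _ 1) => // w; rewrite normr1.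
- exact: measurable_columns.
- exact: measurable_glue.
(* Each copy is constrained only on its own columns; [setT] pads the others with factors of
   probability 1. *)
move=> b; pose B1 j := if K j then box b j else setT; pose B2 j := if K j then setT else box b j.
have mB1 j : measurable (B1 j) by rewrite /B1; case: ifP.
have mB2 j : measurable (B2 j) by rewrite /B2; case: ifP.
transitivity (\prod_j P (event (box b) j))%E.
  rewrite -integral_prod_indic//; apply: eq_integral => w _; congr EFin.
  rewrite mul1r -(prod_entries b (fun j => X j w)).
  by apply: eq_bigr => k _; rewrite mxE.
pose u1 w : R := \prod_j \1_(event B1 j) w; pose u2 w : R := \prod_j \1_(event B2 j) w.
have mu B : (forall j, measurable (B j)) ->
    measurable_fun setT (fun w => \prod_j \1_(event B j) w : R).
  by move=> mB; apply: measurable_prod => j _; apply: measurable_indic; exact: mevent.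
have u0 B w : 0 <= (\prod_j \1_(event B j) w : R) by apply: prodr_ge0 => j _.
transitivity (\int[P \x P]_z (u1 z.1 * u2 z.2)%:E)%E; last first.
  apply: eq_integral => z _; congr EFin; rewrite mul1r.
  transitivity (\prod_j \1_(box b j) (tup_of_cV (if K j then X j z.1 else X j z.2)) : R).
    rewrite /u1 /u2 -big_split/=; apply: eq_bigr => j _; rewrite !indic_event.
    by rewrite /B1 /B2; case: ifP => _; rewrite indicT ?mulr1 ?mul1r.
  rewrite -(prod_entries b (fun j => if K j then X j z.1 else X j z.2)).
  by apply: eq_bigr => k _; rewrite !mxE; case: ifP; rewrite ?mxE.
rewrite ge0_integral_prodM//; [|exact: mu|exact: mu|exact: u0|exact: u0].
rewrite !integral_prod_indic// -big_split/=; apply: eq_bigr => j _.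
have PT B : B j = setT -> P (event B j) = 1%E.
  by move=> BT; rewrite /event BT -[LHS]/(P setT) probability_setT.
have evE B B' : B j = B' j -> event B j = event B' j by move=> e; rewrite /event e.
case: (boolP (K j)) => Kj.
  rewrite (PT B2) ?mule1; last by rewrite /B2 Kj.
  by congr (P _); apply: evE; rewrite /B1 Kj.
rewrite (PT B1) ?mul1e; last by rewrite /B1 (negbTE Kj).
by congr (P _); apply: evE; rewrite /B2 (negbTE Kj).
Qed.

Lemma integrable_resample (K : pred 'I_n) (f : 'M[R]_(d, n) -> R) :
  measurable_fun setT f -> P.-integrable setT (fun w => (f (columns w))%:E) ->
  (\int[P]_w (f (columns w))%:E =
   \int[P]_w \int[P]_w' (f (mx_glue K (columns w) (columns w')))%:E)%E.
Proof.
move=> mf intf; pose F z := (f (mx_glue K (columns z.1) (columns z.2)))%:E.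
have intF : (P \x P)%E.-integrable setT F.
  apply/integrableP; split.
    by apply/measurable_EFinP; exact: (measurableT_comp mf (measurable_glue K)).
  have /integrableP[_] := intf; rewrite (@ge0_resample K (fun M => `|(f M)%:E|%E))//.
  by apply/measurable_EFinP; exact: measurableT_comp.
transitivity (\int[P \x P]_z F z)%E; last first.
  by rewrite -(integral12_prod_meas1 intF).
rewrite [LHS]integralE [RHS]integralE; congr (_ - _)%E.
- transitivity (\int[P]_w ((EFin \o f)^\+ (columns w)))%E.
    by apply: eq_integral => w _; rewrite !funeposE.
  rewrite (@ge0_resample K ((EFin \o f)^\+)%E)//.
    by apply: eq_integral => w _; rewrite !funeposE.
  by apply: measurable_funepos; exact/measurable_EFinP.
- transitivity (\int[P]_w ((EFin \o f)^\- (columns w)))%E.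
    by apply: eq_integral => w _; rewrite !funenegE.
  rewrite (@ge0_resample K ((EFin \o f)^\-)%E)//.
    by apply: eq_integral => w _; rewrite !funenegE.
  by apply: measurable_funeneg; exact/measurable_EFinP.
Qed.

Let colE w k : X k w = col k (columns w).
Proof. by apply/matrixP => a b; rewrite !mxE (ord1 b). Qed.

Let mcol d1 (T : measurableType d1) k (M : T -> 'M[R]_(d, n)) : measurable_fun setT M ->
  measurable_fun setT (fun x => col k (M x)).
Proof.
move=> /measurable_mxP mM; apply/measurable_mxP => a b.
by under eq_fun do rewrite mxE; exact: mM.
Qed.

Let col_glue1 k w w' : col k (mx_glue (pred1 k) (columns w) (columns w')) = X k w.
Proof. by apply/matrixP => a b; rewrite !mxE /= eqxx (ord1 b). Qed.

Let col_glue2 k l w w' : l != k ->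
  col l (mx_glue (pred1 k) (columns w) (columns w')) = X l w'.
Proof. by move=> lk; apply/matrixP => a b; rewrite !mxE /= (negbTE lk) (ord1 b). Qed.

(** Induction peeling off one column, which is separated from the rest by resampling with
    [pred1 (phi i)]. Integrability belongs to the conclusion because the factors, second order
    monomials later on, are unbounded. *)
Lemma indep_prod (I : eqType) (s : seq I) (phi : I -> 'I_n) (f : I -> 'cV[R]_d -> R)
    (e : I -> R) : uniq [seq phi i | i <- s] ->
  (forall i, measurable_fun setT (f i)) ->
  (forall i, P.-integrable setT (fun w => (f i (X (phi i) w))%:E)) ->
  (forall i, \int[P]_w (f i (X (phi i) w))%:E = (e i)%:E)%E ->
  P.-integrable setT (fun w => (\prod_(i <- s) f i (X (phi i) w))%:E) /\
  (\int[P]_w (\prod_(i <- s) f i (X (phi i) w))%:E = (\prod_(i <- s) e i)%:E)%E.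
Proof.
move=> + mf intf ef; elim: s => [_|i s IH /= /andP[nis us]].
  split; first by under eq_fun do rewrite big_nil; apply: (@prob_bounded_integrable _ _ _ P (cst 1) 1) => // w; rewrite normr1.
  under eq_integral do rewrite big_nil.
  by rewrite big_nil integral_cst//= probability_setT mule1.
have [intIH eIH] := IH us.
pose F (M : 'M[R]_(d, n)) := f i (col (phi i) M) * \prod_(k <- s) f k (col (phi k) M).
have mF : measurable_fun setT F.
  apply: measurable_funM; first exact: (measurableT_comp (mf i) (mcol _ _)).
  apply: measurable_prod => k _; exact: (measurableT_comp (mf k) (mcol _ _)).
have neq k : k \in s -> phi k != phi i.
  by move=> ks; apply: contraNneq nis => <-; exact: map_f.
have glueE w w' : F (mx_glue (pred1 (phi i)) (columns w) (columns w')) =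
    f i (X (phi i) w) * \prod_(k <- s) f k (X (phi k) w').
  by rewrite /F col_glue1; congr (_ * _); apply: eq_big_seq => k ks; rewrite col_glue2// neq.
have FE w : F (columns w) = \prod_(k <- i :: s) f k (X (phi k) w).
  by rewrite big_cons /F -colE; congr (_ * _); apply: eq_bigr => k _; rewrite -colE.
(* The absolute value is nonnegative, so it can be resampled before integrability is known, and its
   integral then factors. *)
have intF : P.-integrable setT (fun w => (F (columns w))%:E).
  apply/integrableP; split.
    by apply/measurable_EFinP; exact: (measurableT_comp mF measurable_columns).
  rewrite (@ge0_resample (pred1 (phi i)) (fun M => `|(F M)%:E|%E))//; last first.
    by apply/measurable_EFinP; exact: measurableT_comp.
  under eq_integral do rewrite /= glueE normrM.
  rewrite (@ge0_integral_prodM _ _ _ _ _ P P (fun w => `|f i (X (phi i) w)|)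
     (fun w => `|\prod_(k <- s) f k (X (phi k) w)|))//.
  - have /integrableP[_ h1] := intf i; have /integrableP[_ h2] := intIH.
    by rewrite lte_mul_pinfty// ?ge0_fin_numE ?integral_ge0.
  - by apply: measurableT_comp => //; exact: (measurableT_comp (mf i) (measurable_column _)).
  - apply: measurableT_comp => //; apply: measurable_prod => k _.
    exact: (measurableT_comp (mf k) (measurable_column _)).
split.
  by apply: eq_integrable intF => // w _; rewrite FE.
under eq_integral do rewrite -FE.
rewrite (integrable_resample (pred1 (phi i)) mF intF).
under eq_integral do under eq_integral do rewrite glueE EFinM.
transitivity (\int[P]_w ((f i (X (phi i) w))%:E * (\prod_(k <- s) e k)%:E))%E.
  by apply: eq_integral => w _; rewrite integralZl// eIH.
by rewrite integralZr// ef big_cons EFinM.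
Qed.

(** The cosine of a sum is not a product, but with the other columns held fixed their contribution
    is a mere phase; quantifying over all [c] closes the induction. *)
Lemma indep_charfn (I : eqType) (s : seq I) (phi : I -> 'I_n) (a : I -> 'cV[R]_d)
    (q : I -> R) : uniq [seq phi i | i <- s] ->
  (forall i c, \int[P]_w (cos (mxdot (a i) (X (phi i) w) + c))%:E =
    (expR (- q i) * cos c)%:E)%E ->
  forall c, (\int[P]_w (cos (\sum_(i <- s) mxdot (a i) (X (phi i) w) + c))%:E =
    (expR (- \sum_(i <- s) q i) * cos c)%:E)%E.
Proof.
move=> + h; elim: s => [_|i s IH /= /andP[nis us]] c.
  under eq_integral do rewrite big_nil add0r.
  by rewrite big_nil oppr0 expR0 mul1r integral_cst//= probability_setT mule1.
have neq k : k \in s -> phi k != phi i.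
  by move=> ks; apply: contraNneq nis => <-; exact: map_f.
pose F (M : 'M[R]_(d, n)) := cos (mxdot (a i) (col (phi i) M) +
  (\sum_(k <- s) mxdot (a k) (col (phi k) M) + c)).
have mF : measurable_fun setT F.
  apply: (measurableT_comp (continuous_measurable_fun (@continuous_cos R))).
  apply: measurable_funD; first by apply: measurable_mxdot; exact: mcol.
  apply: measurable_funD => //; apply: measurable_sum => k.
  by apply: measurable_mxdot; exact: mcol.
have intF : P.-integrable setT (fun w => (F (columns w))%:E).
  apply: (@prob_bounded_integrable _ _ _ P (F \o columns) 1) => [|w]; last exact: norm_cos_le1.
  exact: (measurableT_comp mF measurable_columns).
have FE w : F (columns w) = cos (\sum_(k <- i :: s) mxdot (a k) (X (phi k) w) + c).
  rewrite /F big_cons addrA -colE; congr (cos (_ + _ + _)).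
  by apply: eq_bigr => k _; rewrite -colE.
under eq_integral do rewrite -FE.
rewrite (integrable_resample (pred1 (phi i)) mF intF).
rewrite (@bounded_Fubini _ _ _ _ _ P P
  (fun z => F (mx_glue (pred1 (phi i)) (columns z.1) (columns z.2))) 1); last 2 first.
- exact: (measurableT_comp mF (measurable_glue _)).
- by move=> z; exact: norm_cos_le1.
transitivity (\int[P]_w ((expR (- q i))%:E *
    (cos (\sum_(k <- s) mxdot (a k) (X (phi k) w) + c))%:E))%E.
  apply: eq_integral => w' _ /=; rewrite -EFinM -h; apply: eq_integral => w _.
  rewrite /F col_glue1; congr ((cos (_ + (_ + _)))%:E).
  by apply: eq_big_seq => k ks; rewrite col_glue2// neq.
rewrite integralZl//; last first.
  apply: (@prob_bounded_integrable _ _ _ P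
    (fun w => cos (\sum_(k <- s) mxdot (a k) (X (phi k) w) + c)) 1) => [|w]; last exact: norm_cos_le1.
  apply: (measurableT_comp (continuous_measurable_fun (@continuous_cos R))).
  apply: measurable_funD => //; apply: measurable_sum => k.
  by apply: measurable_mxdot; exact: measurable_column.
by rewrite IH// -EFinM mulrA -expRD big_cons opprD.
Qed.

End independent_columns.

(** * Tilted Gaussian vectors *)

Section quadratic_forms.
Context {R : realType}.

Definition qform {d} (S : 'M[R]_d) (a : 'cV[R]_d) : R := (a^T *m S *m a) 0 0.

Lemma mxdot_cV d (a x : 'cV[R]_d) : mxdot a x = (a^T *m x) 0 0.
Proof. by rewrite /mxdot trace_mx11. Qed.

Lemma qform_shift d (S : 'M[R]_d) (a v : 'cV[R]_d) (y : R) : S^T = S ->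
  qform S (a + y *: v) = qform S a + 2 * y * (a^T *m S *m v) 0 0 + y ^+ 2 * qform S v.
Proof.
move=> ST; rewrite /qform.
have -> : (a + y *: v)^T = a^T + y *: v^T by apply/matrixP => i j; rewrite !mxE.
rewrite !mulmxDl !mulmxDr.
rewrite -!scalemxAl -!scalemxAr !scalerA.
have -> : v^T *m S *m a = (a^T *m S *m v)^T by rewrite !trmx_mul trmxK ST mulmxA.
rewrite !mxE; ring.
Qed.

(** The rank-one case of Sylvester's determinant identity, from two block triangular factorisations
    of one matrix. *)
Lemma det_one_sub_mul d (u : 'cV[R]_d) (w : 'rV[R]_d) :
  \det (1%:M - u *m w) = 1 - (w *m u) 0 0.
Proof.
have e1 : block_mx 1%:M w u 1%:M = block_mx 1%:M 0 u 1%:M *m block_mx 1%:M w 0 (1%:M - u *m w).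
  by rewrite mulmx_block !mul1mx !mulmx1 !mulmx0 !mul0mx !addr0 addrC subrK.
have e2 : block_mx 1%:M w u 1%:M = block_mx (1%:M - w *m u) w 0 1%:M *m block_mx 1%:M 0 u 1%:M.
  by rewrite mulmx_block ?mul1mx ?mulmx1 ?mulmx0 ?mul0mx ?add0r ?addr0 subrK.
have := congr1 determinant e1; rewrite e2 !det_mulmx !det_lblock !det_ublock !det1 !mulr1 !mul1r.
by move=> <-; rewrite det_mx11 !mxE.
Qed.

End quadratic_forms.

Section tilted_gaussian.
Context {R : realType} {d0 : measure_display} {Omega : measurableType d0}.
Variables (P : probability Omega R) (d : nat) (Sigma : 'M[R]_d).
Hypothesis pd : posdef Sigma.

(** A characteristic function only sees projections, and these are normal by hypothesis. The
    direction a = 0, which the hypothesis excludes, is computed directly. *)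
Lemma gaussian_charfn (X : Omega -> 'cV[R]_d) : is_gaussian0 P Sigma X -> forall a c,
  (\int[P]_w (cos (mxdot a (X w) + c))%:E = (expR (- (qform Sigma a / 2)) * cos c)%:E)%E.
Proof.
move=> [mXt gX] a c; have [->|a0] := eqVneq a 0.
  under eq_integral do rewrite mxdot0l add0r.
  rewrite /qform trmx0 !mul0mx mxE mul0r oppr0 expR0 mul1r.
  by rewrite integral_cst//= probability_setT mule1.
have mX : measurable_fun setT X.
  apply/measurable_mxP => i j; rewrite (ord1 j).
  rewrite (_ : (fun w => _) = (fun w => tnth (tup_of_cV (X w)) i)).
    exact: (measurableT_comp (measurable_tnth i) mXt).
  by apply/funext => w; rewrite tnth_mktuple.
have mY : measurable_fun setT (fun w => mxdot a (X w)) by exact: measurable_mxdot.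
have q0 : 0 < qform Sigma a by case: pd => _; exact.
have mc : measurable_fun setT (fun y : measurableTypeR R => (cos (y + c))%:E).
  apply/measurable_EFinP.
  apply: (measurableT_comp (continuous_measurable_fun (@continuous_cos R))).
  exact: measurable_funD.
have mY' : measurable_fun setT ((fun w => mxdot a (X w)) : Omega -> measurableTypeR R).
  by move=> _ B mB; exact: mY.
pose Y : {mfun Omega >-> measurableTypeR R} :=
  HB.pack ((fun w => mxdot a (X w)) : Omega -> measurableTypeR R)
    (isMeasurableFun.Build _ _ _ _ _ mY').
have <- : (\int[distribution P Y]_y (cos (y + c))%:E =
    \int[P]_w (cos (mxdot a (X w) + c))%:E)%E.
  apply: (@integral_distribution _ _ _ _ _ P Y _ mc).
  apply: (@prob_bounded_integrable _ _ _ P (fun w => cos (mxdot a (X w) + c)) 1) => [|w].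
    by apply/measurable_EFinP; exact: (measurableT_comp mc mY).
  exact: norm_cos_le1.
transitivity (\int[normal_prob 0 (Num.sqrt (qform Sigma a))]_y (cos (y + c))%:E)%E.
  have mE B : measurable B -> B `<=` setT ->
      distribution P Y B = normal_prob 0 (Num.sqrt (qform Sigma a)) B.
    move=> mB _; rewrite /distribution /pushforward -(gX a a0 B mB).
    by congr (P _); apply/seteqP; split => w /=; rewrite mxdot_cV.
  exact: (@eq_measure_integral _ _ _ setT _ _ _ mE).
under eq_integral do rewrite -[X in cos (X + _)]mul1r.
rewrite normal_charfn; last by rewrite gt_eqF// sqrtr_gt0.
by rewrite mul1r sqr_sqrtr ?(ltW q0)// mulNr.
Qed.

Variable X : Omega -> 'cV[R]_d.
Hypotheses (mX : measurable_fun setT X) (gX : is_gaussian0 P Sigma X).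

(* The weight [h] turns the law of X into [Phi] times a centered Gaussian law of covariance [S]. *)
Record tilted (h : 'cV[R]_d -> R) (Phi : R) (S : 'M[R]_d) : Prop := Tilted {
  tilted_meas : measurable_fun setT h;
  tilted_bound : forall x, 0 <= h x <= 1;
  tilted_gt0 : 0 < Phi;
  tilted_sym : S^T = S;
  tilted_det : \det S = \det Sigma * Phi ^+ 2;
  tilted_charfn : forall a c, (\int[P]_w (h (X w) * cos (mxdot a (X w) + c))%:E =
    (Phi * expR (- (qform S a / 2)) * cos c)%:E)%E }.

Lemma tilted1 : tilted (cst 1) 1 Sigma.
Proof.
split => //.
- by move=> x; rewrite /= ler01 lexx.
- by case: pd.
- by rewrite expr1n mulr1.
- by move=> a c; under eq_integral do rewrite mul1r; rewrite mul1r gaussian_charfn.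
Qed.

Lemma tilted_int h Phi S : tilted h Phi S -> (\int[P]_w (h (X w))%:E = Phi%:E)%E.
Proof.
move=> tS; have := tilted_charfn tS 0 0.
under eq_integral do rewrite mxdot0l addr0 cos0 mulr1.
by rewrite /qform trmx0 !mul0mx mxE mul0r oppr0 expR0 cos0 !mulr1.
Qed.

Lemma tilted_measX h Phi S : tilted h Phi S -> measurable_fun setT (fun w => h (X w)).
Proof. by case=> mh *; exact: (measurableT_comp mh mX). Qed.

Lemma tilted_norm h Phi S x : tilted h Phi S -> `|h x| <= 1.
Proof. by case=> _ /(_ x)/andP[h0 h1] *; rewrite ger0_norm. Qed.

(** [S] is known only through the transform: as a cosine is at most 1, [Phi * exp (- q / 2) <= Phi],
    which forces q >= 0. *)
Lemma tilted_psd h Phi S a : tilted h Phi S -> 0 <= qform S a.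
Proof.
move=> tS; have [mh hb P0 _ _ hc] := tS.
have : (\int[P]_w (h (X w) * cos (mxdot a (X w) + 0))%:E <= \int[P]_w (h (X w))%:E)%E.
  have mcos : measurable_fun setT (fun w => cos (mxdot a (X w) + 0)).
    apply: (measurableT_comp (continuous_measurable_fun (@continuous_cos R))).
    by apply: measurable_funD => //; exact: measurable_mxdot.
  apply: le_integral => //.
  - apply: (@prob_bounded_integrable _ _ _ P _ 1) => [|w].
      by apply: measurable_funM => //; exact: tilted_measX tS.
    by rewrite normrM mulr_ile1 ?norm_cos_le1 ?(tilted_norm _ tS).
  - apply: (@prob_bounded_integrable _ _ _ P _ 1) => [|w]; first exact: tilted_measX tS.
    exact: tilted_norm tS.
  - by move=> w _; rewrite lee_fin ler_piMr ?cos_le1//; case/andP: (hb (X w)).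
rewrite hc (tilted_int tS) lee_fin cos0 mulr1 ger_pMr// expR_le1 oppr_le0.
by rewrite pmulr_lge0// invr_gt0.
Qed.

(** For invertible S the new covariance is the Sherman-Morrison form of (S^-1 + 2 t v v^T)^-1.
    Smoothing writes the new factor as a normal average of phases, that is, of the old transform at
    shifted points a + s y v, and the average is an explicit Gaussian integral. *)
Lemma tilted_step h Phi S (t : R) v : 0 <= t -> tilted h Phi S ->
  tilted (fun x => h x * expR (- (t * mxdot v x ^+ 2)))
    (Phi / Num.sqrt (1 + 2 * t * qform S v))
    (S - (2 * t / (1 + 2 * t * qform S v)) *: (S *m v *m (v^T *m S))).
Proof.
move=> t0 tS; have [mh hb P0 ST Sd hc] := tS.
set q := qform S v; have q0 : 0 <= q by exact: tilted_psd tS.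
have q1 : 0 < 1 + 2 * t * q by rewrite ltr_pwDl// !mulr_ge0.
have mexp : measurable_fun setT (fun x : 'cV[R]_d => expR (- (t * mxdot v x ^+ 2))).
  apply: (@measurable_expRN _ _ _ (fun x => mxdot v x ^+ 2)).
  by apply: measurable_funX; exact: measurable_mxdot.
split.
- exact: measurable_funM.
- move=> x; have /andP[h0 h1] := hb x; rewrite mulr_ge0 ?expR_ge0//= mulr_ile1 ?expR_ge0//.
  by rewrite expR_le1 oppr_le0 mulr_ge0 ?sqr_ge0.
- by rewrite divr_gt0// sqrtr_gt0.
- by rewrite linearB/= linearZ/= !trmx_mul trmxK ST mulmxA.
(* With S factored out, the determinant of the rank-one perturbation is 1 - 2tq / (1 + 2tq) = 1 / (1
   + 2tq), the square of the factor gained by [Phi]. *)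
- have -> : S - (2 * t / (1 + 2 * t * q)) *: (S *m v *m (v^T *m S)) =
      S *m (1%:M - v *m ((2 * t / (1 + 2 * t * q)) *: (v^T *m S))).
    by rewrite mulmxBr mulmx1 -!scalemxAr !mulmxA.
  rewrite det_mulmx det_one_sub_mul -scalemxAl mxE -/(qform S v) -/q Sd.
  rewrite exprMn exprVn sqr_sqrtr ?(ltW q1)//.
  by field; rewrite gt_eqF.
move=> a c; rewrite gauss_smoothing//; last 4 first.
- exact: tilted_measX tS.
- by move=> w; exact: tilted_norm tS.
- exact: measurable_mxdot.
- by apply: measurable_funD => //; exact: measurable_mxdot.
set s := Num.sqrt (2 * t); have s2 : s ^+ 2 = 2 * t by rewrite sqr_sqrtr ?mulr_ge0.
set b := (a^T *m S *m v) 0 0.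
transitivity (\int[normal_prob 0 1]_y ((Phi * cos c)%:E *
   (expR (- (qform S a / 2 + (s * b) * y + (2 * t * q) * y ^+ 2 / 2)))%:E))%E.
  apply: eq_integral => y _.
  transitivity (\int[P]_w (h (X w) * cos (mxdot (a + (s * y) *: v) (X w) + c))%:E)%E.
    apply: eq_integral => w _; rewrite mxdotDl mxdotZl; congr ((_ * cos _)%:E); ring.
  rewrite hc -EFinM; congr EFin; rewrite mulrAC; congr (_ * expR _).
  by rewrite qform_shift// -/b -/q exprMn s2; field.
(* The exponent is half the quadratic form of S at [a + (s * y) *: v]. *)
have qpos y : 0 <= qform S a / 2 + (s * b) * y + (2 * t * q) * y ^+ 2 / 2.
  have := tilted_psd (a + (s * y) *: v) tS; rewrite qform_shift// -/b -/q exprMn s2 => h'.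
  by lra.
rewrite integralZl//; last first.
  apply: (@prob_bounded_integrable _ _ _ (normal_prob 0 1) (fun y =>
    expR (- (qform S a / 2 + (s * b) * y + (2 * t * q) * y ^+ 2 / 2))) 1) => [|y].
    apply: measurableT_comp => //; apply: measurableT_comp => //.
    apply: measurable_funD; first by apply: measurable_funD => //; exact: measurable_funM.
    by apply: measurable_funM => //; apply: measurable_funM => //; exact: measurable_funX.
  by rewrite ger0_norm ?expR_ge0// expR_le1 oppr_le0.
rewrite normal_gauss_transform//; last by rewrite !mulr_ge0.
rewrite -EFinM; congr EFin.
have -> : qform (S - (2 * t / (1 + 2 * t * q)) *: (S *m v *m (v^T *m S))) a =
   qform S a - (2 * t / (1 + 2 * t * q)) * b ^+ 2.
  have lin (M N : 'M[R]_1) k : (M - k *: N) 0 0 = M 0 0 - k * N 0 0 by rewrite !mxE.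
  rewrite /qform mulmxBr mulmxBl -scalemxAr -scalemxAl lin; congr (_ - _ * _).
  have -> : a^T *m (S *m v *m (v^T *m S)) *m a =
    (a^T *m S *m v) *m (a^T *m S *m v)^T by rewrite !trmx_mul !trmxK ST !mulmxA.
  rewrite /b; move: (a^T *m S *m v) => u.
  by rewrite mxE big_ord1 [u^T _ _]mxE expr2.
have -> : - (qform S a / 2) + (s * b) ^+ 2 / (2 * (1 + 2 * t * q)) =
    - ((qform S a - (2 * t / (1 + 2 * t * q)) * b ^+ 2) / 2).
  by rewrite exprMn s2; field; rewrite gt_eqF.
by ring.
Qed.

(* [n (1 - exp (- y / n))] tends to [y], and its integral is known from [tilted_step]. *)
Lemma tilted_moment2 h Phi S a : tilted h Phi S ->
  (\int[P]_w (h (X w) * mxdot a (X w) ^+ 2)%:E = (Phi * qform S a)%:E)%E.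
Proof.
move=> tS; have [mh hb P0 _ _ _] := tS.
have q0 := tilted_psd a tS; set q := qform S a in q0 *.
pose y w := mxdot a (X w) ^+ 2.
have y0 w : 0 <= y w by exact: sqr_ge0.
have my : measurable_fun setT y by apply: measurable_funX; exact: measurable_mxdot.
pose tau n : R := n.+1%:R^-1.
have tau0 n : 0 < tau n by rewrite invr_gt0.
have tauge0 n : 0 <= tau n by exact: ltW.
pose f n w := h (X w) * ((1 - expR (- (tau n * y w))) / tau n).
have mhX := tilted_measX tS.
have h0 w : 0 <= h (X w) by case/andP: (hb (X w)).
have f0 n w : 0 <= f n w.
  apply: mulr_ge0 => //; apply: divr_ge0; last exact: ltW.
  by rewrite subr_ge0 expR_le1 oppr_le0 mulr_ge0// ltW.
have fy n w : f n w <= h (X w) * y w.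
  rewrite ler_wpM2l// ler_pdivrMr// mulrC lerBlDr -lerBlDl.
  by rewrite (le_trans _ (expR_ge1Dx _)).
have mf n : measurable_fun setT (f n).
  apply: measurable_funM => //; apply: measurable_funM => //.
  by apply: measurable_funB => //; exact: measurable_expRN.
pose r n := Num.sqrt (1 + 2 * tau n * q).
have r1 n : 1 <= r n by rewrite -[leLHS]sqrtr1 ler_wsqrtr// lerDl !mulr_ge0.
have r2 n : r n ^+ 2 = 1 + 2 * tau n * q.
  by rewrite sqr_sqrtr// addr_ge0// !mulr_ge0.
(* As r^2 = 1 + 2 tau q, the quotient (1 - 1/r) / tau equals 2q / (r (r + 1)), whose limit is no
   longer of the form 0/0. *)
have If n : (\int[P]_w (f n w)%:E = (Phi * (2 * q / (r n * (r n + 1))))%:E)%E.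
  have tS' := tilted_step a (ltW (tau0 n)) tS.
  have := tilted_int tS'; have := tilted_int tS => I1 I2.
  have i1 : P.-integrable setT (EFin \o (fun w => h (X w))).
    by apply: (@prob_bounded_integrable _ _ _ P _ 1) => // w; exact: tilted_norm tS.
  have i2 : P.-integrable setT (EFin \o (fun w => h (X w) * expR (- (tau n * y w)))).
    apply: (@prob_bounded_integrable _ _ _ P _ 1) => [|w].
      exact: (tilted_measX tS').
    exact: (tilted_norm _ tS').
  transitivity (\int[P]_w ((tau n)^-1%:E *
      ((h (X w))%:E - (h (X w) * expR (- (tau n * y w)))%:E)))%E.
    by apply: eq_integral => w _; rewrite -EFinB -EFinM /f; congr EFin; ring.
  rewrite integralZl//; last exact: integrableB.
  rewrite integralB_EFin// I1 I2 -EFinB -EFinM -/q -/(r n); congr EFin.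
  have rn0 : r n != 0 by rewrite gt_eqF// (lt_le_trans _ (r1 n)).
  have rn1 : r n + 1 != 0 by rewrite gt_eqF// addr_gt0// (lt_le_trans _ (r1 n)).
  have -> : 2 * q = (r n ^+ 2 - 1) / tau n.
    by rewrite r2; field; rewrite gt_eqF.
  by field; rewrite rn0 rn1 gt_eqF.
have cr : r n @[n --> \oo] --> (1 : R).
  rewrite -[X in _ --> X]sqrtr1; apply: (continuous_cvg _ (@sqrt_continuous R 1)).
  rewrite -[X in _ --> X]addr0; apply: cvgD; first exact: cvg_cst.
  rewrite -[X in _ --> X](mul0r q); apply: cvgMr_tmp.
  rewrite -[X in _ --> X](mulr0 (2 : R)); apply: cvgMl_tmp.
  exact: cvg_harmonic.
have cv : (Phi * (2 * q / (r n * (r n + 1))))%:E @[n --> \oo] --> (Phi * q)%:E.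
  apply: cvg_EFin; first exact: nearW.
  apply: cvgMl_tmp; rewrite [X in _ --> X](_ : _ = 2 * q / (1 * (1 + 1))); last by field.
  apply: cvgMl_tmp; apply: cvgV; first by rewrite mul1r gt_eqF.
  by apply: cvgM => //; apply: cvgD => //; exact: cvg_cst.
have cf w : (f n w)%:E @[n --> \oo] --> (h (X w) * y w)%:E.
  apply: cvg_EFin; first exact: nearW.
  apply: cvgMl_tmp.
  (* From [1 + u <= exp u] at u = tau y and at u = - tau y: y / (1 + tau y) <= (1 - exp (- tau y)) /
     tau <= y. *)
  apply: (@squeeze_cvgr _ _ _ _ (fun n => y w / (1 + tau n * y w)) (cst (y w))).
  - apply: nearW => n; apply/andP; split.
      have u0 : 0 <= tau n * y w by rewrite mulr_ge0.
      rewrite ler_pdivlMr//.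
      have -> : y w / (1 + tau n * y w) * tau n = 1 - (1 + tau n * y w)^-1.
        by field; rewrite gt_eqF// ltr_pwDl.
      rewrite lerD2l lerN2 expRN lef_pV2 ?posrE ?expR_gt0 ?ltr_pwDl//.
      exact: expR_ge1Dx.
    by rewrite /= ler_pdivrMr// mulrC lerBlDr -lerBlDl (le_trans _ (expR_ge1Dx _)).
  - rewrite [X in _ --> X](_ : _ = y w / (1 + 0 * y w)); last by rewrite mul0r addr0 divr1.
    apply: cvgMl_tmp; apply: cvgV; first by rewrite mul0r addr0 oner_eq0.
    apply: cvgD; first exact: cvg_cst.
    by apply: cvgMr_tmp; exact: cvg_harmonic.
  - exact: cvg_cst.
(* Fatou's lemma bounds the second moment from above; [f n <= h y] bounds it from below. *)
apply/eqP; rewrite eq_le; apply/andP; split.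
  have := @fatou _ _ _ P setT measurableT (fun n w => (f n w)%:E).
  under eq_integral do rewrite (cvg_limn_einf_sup (cf _)).1.
  under [X in limn_einf X]eq_fun do rewrite If.
  rewrite (cvg_limn_einf_sup cv).1; apply.
  - by move=> n; exact/measurable_EFinP.
  - by move=> n w _; rewrite lee_fin.
rewrite -(cvg_lim _ cv)//; apply: lime_le; first by apply/cvg_ex; exists (Phi * q)%:E.
apply: nearW => n; rewrite -If; apply: ge0_le_integral => //.
- by move=> w _; rewrite lee_fin.
- exact/measurable_EFinP.
- by apply/measurable_EFinP; exact: measurable_funM.
- by move=> w _; rewrite lee_fin.
Qed.

Lemma tilted_integrable2 h Phi S a : tilted h Phi S ->
  P.-integrable setT (EFin \o (fun w => h (X w) * mxdot a (X w) ^+ 2)).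
Proof.
move=> tS; apply/integrableP; split.
  apply/measurable_EFinP; apply: measurable_funM; first exact: tilted_measX tS.
  by apply: measurable_funX; exact: measurable_mxdot.
have [_ hb _ _ _ _] := tS.
under eq_integral.
  move=> w _; rewrite /= ger0_norm; last first.
    by rewrite mulr_ge0 ?sqr_ge0//; case/andP: (hb (X w)).
  over.
by rewrite (tilted_moment2 _ tS) ltry.
Qed.

(** Polarisation of [tilted_moment2]; the scalar in [1 *: ek] gives the sum the shape of
    [qform_shift]. *)
Lemma tilted_cov h Phi S i k : tilted h Phi S ->
  P.-integrable setT (EFin \o (fun w => X w i 0 * X w k 0 * h (X w))) /\
  (\int[P]_w (X w i 0 * X w k 0 * h (X w))%:E = (Phi * S i k)%:E)%E.
Proof.
move=> tS; have [_ _ _ ST _ _] := tS.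
pose ei : 'cV[R]_d := delta_mx i 0; pose ek : 'cV[R]_d := delta_mx k 0.
have i1 := tilted_integrable2 (ei + 1 *: ek) tS.
have i2 := tilted_integrable2 ei tS; have i3 := tilted_integrable2 ek tS.
have qe (a b : 'I_d) : ((delta_mx a 0 : 'cV[R]_d)^T *m S *m (delta_mx b 0 : 'cV[R]_d)) 0 0 = S a b.
  by rewrite trmx_delta -rowE -colE !mxE.
have E w : X w i 0 * X w k 0 * h (X w) = 2^-1 * (h (X w) * mxdot (ei + 1 *: ek) (X w) ^+ 2 -
    h (X w) * mxdot ei (X w) ^+ 2 - h (X w) * mxdot ek (X w) ^+ 2).
  by rewrite mxdotDl mxdotZl !mxdot_delta; field.
have i4 := integrableB measurableT (integrableB measurableT i1 i2) i3.
split.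
  apply: eq_integrable (integrableZl measurableT 2^-1 i4) => // w _.
  by rewrite [RHS]/= E.
transitivity (\int[P]_w ((2^-1)%:E * ((h (X w) * mxdot (ei + 1 *: ek) (X w) ^+ 2)%:E -
    (h (X w) * mxdot ei (X w) ^+ 2)%:E - (h (X w) * mxdot ek (X w) ^+ 2)%:E)))%E.
  by apply: eq_integral => w _; rewrite E EFinM !EFinB.
rewrite (integralZl _ i4)//.
rewrite (integralB measurableT (integrableB measurableT i1 i2) i3).
rewrite (integralB measurableT i1 i2) !(tilted_moment2 _ tS) -!EFinB -EFinM; congr EFin.
by rewrite qform_shift// {1}/qform !qe /qform !qe; field.
Qed.

End tilted_gaussian.

(** * The Gram matrices of the two blocks *)

(** For fixed first permutation the inner sum is, up to its sign, the determinant with permuted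
    rows; the signs cancel and d! equal terms remain. *)
Lemma sum_perm_sign {R : realType} d (N : 'M[R]_d) :
  \sum_(p : 'S_d * 'S_d) ((-1) ^+ p.1 * (-1) ^+ p.2) * \prod_j N (p.1 j) (p.2 j) =
  d`!%:R * \det N.
Proof.
transitivity (\sum_(s : 'S_d) \det N); last first.
  rewrite sumr_const [RHS]mulr_natl; congr (_ *+ _).
  by rewrite -card_Sn; apply: eq_card.
rewrite -(pair_big predT predT (fun s r : 'S_d =>
  ((-1) ^+ s * (-1) ^+ r) * \prod_j N (s j) (r j)))/=.
apply: eq_bigr => s _.
transitivity ((-1) ^+ s * \det (row_perm s N)).
  rewrite /determinant mulr_sumr; apply: eq_bigr => r _; rewrite -mulrA; congr (_ * (_ * _)).
  by apply: eq_bigr => j _; rewrite mxE.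
by rewrite row_permE det_mulmx det_perm mulrA -expr2 sqrr_sign mul1r.
Qed.

Section gaussian_sample.
Context {R : realType} {d0 : measure_display} {Omega : measurableType d0}.
Variables (P : probability Omega R) (d : nat) (Sigma : 'M[R]_d) (n : nat).
Hypothesis pd : posdef Sigma.
Variable X : 'I_n -> Omega -> 'cV[R]_d.
Hypothesis hgauss : forall k, is_gaussian0 P Sigma (X k).
Hypothesis indep : mutually_independent P X.

Let mXt k : measurable_fun setT (fun w => tup_of_cV (X k w)).
Proof. by case: (hgauss k). Qed.

Let mX k : measurable_fun setT (X k).
Proof. exact: measurable_column. Qed.

(** Iterates the rank-one tilt. [Phi] and [S] precede the quantifier over k, since all vectors share
    the covariance [Sigma]. *)
Lemma tilted_family (I : Type) (s : seq I) (t : I -> R) (v : I -> 'cV[R]_d) :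
  (forall i, 0 <= t i) -> exists Phi S, forall k,
  tilted P Sigma (X k) (fun x => \prod_(i <- s) expR (- (t i * mxdot (v i) x ^+ 2))) Phi S.
Proof.
move=> t0; elim: s => [|i s [Phi [S tS]]].
  exists 1, Sigma => k; rewrite (_ : (fun x => _) = cst 1); first exact: tilted1.
  by apply/funext => x; rewrite big_nil.
eexists; eexists => k; have := tilted_step (mX k) (v i) (t0 i) (tS k).
rewrite (_ : (fun x => \prod_(j <- i :: s) _) = (fun x => \prod_(j <- s)
   expR (- (t j * mxdot (v j) x ^+ 2)) * expR (- (t i * mxdot (v i) x ^+ 2)))); first exact.
by apply/funext => x; rewrite big_cons mulrC.
Qed.

Variable phi : 'I_d -> 'I_n.
Hypothesis phi_inj : injective phi.

Definition sample_mx (w : Omega) : 'M[R]_d := \matrix_(i, j) X (phi j) w i 0.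

(** The squared determinant is a double sum over permutations of products over the columns. By
    independence each product has mean [prod_j (Phi * S (p.1 j) (p.2 j))], and the signed sum is d!
    det (Phi S). *)
Lemma sample_moment (k0 : 'I_n) h Phi S : (forall k, tilted P Sigma (X k) h Phi S) ->
  P.-integrable setT (fun w => (\det (sample_mx w) ^+ 2 * \prod_j h (X (phi j) w))%:E) /\
  (\int[P]_w (\det (sample_mx w) ^+ 2 * \prod_j h (X (phi j) w))%:E =
   (d`!%:R * \det Sigma * Phi ^+ (d + 2))%:E)%E.
Proof.
move=> tS.
pose f (p : 'S_d * 'S_d) (j : 'I_d) (x : 'cV[R]_d) := x (p.1 j) 0 * x (p.2 j) 0 * h x.
pose F (p : 'S_d * 'S_d) w : R := \prod_(j <- index_enum 'I_d) f p j (X (phi j) w).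
have E w : \det (sample_mx w) ^+ 2 * \prod_j h (X (phi j) w) =
    \sum_(p : 'S_d * 'S_d) ((-1) ^+ p.1 * (-1) ^+ p.2) * F p w.
  (* After transposition the permutations act on row indices, so the factor of index j involves the
     single vector [X (phi j)]. *)
  rewrite expr2 -{1 2}det_tr /determinant big_distrlr/= pair_big/= mulr_suml.
  apply: eq_bigr => p _; rewrite mulrACA -[LHS]mulrA; congr (_ * _).
  rewrite -!big_split/=; apply: eq_bigr => j _.
  by rewrite /f !mxE.
have mf p j : measurable_fun setT (f p j).
  apply: measurable_funM; last by case: (tS (phi j)).
  by apply: measurable_funM; exact: measurable_mxentry.
have key p := @indep_prod _ _ _ P d n X mXt indep 'I_d (index_enum 'I_d) phi (f p)
  (fun j => Phi * S (p.1 j) (p.2 j)) _ (mf p)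
  (fun j => (tilted_cov (mX (phi j)) (p.1 j) (p.2 j) (tS (phi j))).1)
  (fun j => (tilted_cov (mX (phi j)) (p.1 j) (p.2 j) (tS (phi j))).2).
have {}key p : P.-integrable setT (fun w => (F p w)%:E) /\
    (\int[P]_w (F p w)%:E = (\prod_j (Phi * S (p.1 j) (p.2 j)))%:E)%E.
  by apply: key; rewrite map_inj_uniq ?index_enum_uniq.
have ip (p : 'S_d * 'S_d) : P.-integrable setT (fun w => (((-1) ^+ p.1 * (-1) ^+ p.2)%:E * (F p w)%:E)%E).
  by apply: integrableZl => //; case: (key p).
have EE w : (\det (sample_mx w) ^+ 2 * \prod_j h (X (phi j) w))%:E =
   (\sum_(p : 'S_d * 'S_d) ((-1) ^+ p.1 * (-1) ^+ p.2)%:E * (F p w)%:E)%E.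
  by rewrite E -sumEFin; apply: eq_bigr => p _; rewrite EFinM.
split.
  rewrite (funext EE).
  by apply: (@integrable_sum _ _ _ P setT measurableT) => p _; exact: ip.
under eq_integral do rewrite EE.
rewrite integral_sum//.
transitivity ((\sum_(p : 'S_d * 'S_d) ((-1) ^+ p.1 * (-1) ^+ p.2) *
    \prod_j (Phi *: S) (p.1 j) (p.2 j))%:E); last first.
  rewrite sum_perm_sign detZ (tilted_det (tS k0)) exprD; congr EFin; ring.
rewrite -sumEFin; apply: eq_bigr => p _; rewrite integralZl//; last by case: (key p).
rewrite (key p).2 -EFinM; congr ((_ * _)%:E).
by apply: eq_bigr => j _; rewrite mxE.
Qed.

End gaussian_sample.

Section gram_law.
Context {R : realType}.

Definition pair_dir {d} (p : 'I_d * 'I_d) : 'cV[R]_d := delta_mx p.1 0 + 1 *: delta_mx p.2 0.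

(* A symmetric S is recovered from the nonnegative numbers [(e_i + e_j)^T S (e_i + e_j)] to which
   the uniqueness of Laplace transforms applies. *)
Definition gram_coord {d} (S : 'M[R]_d) : 'M[R]_d :=
  \matrix_(i, j) qform S (pair_dir (i, j)).

(** Here U i j = S i i + 2 S i j + S j j, and in particular U i i = 4 S i i; this is the origin of
    the constants. *)
Definition gram_of_coord {d} (U : 'M[R]_d) : 'M[R]_d :=
  \matrix_(i, j) (2^-1 * (U i j - 4^-1 * U i i - 4^-1 * U j j)).

Lemma qform_delta d (S : 'M[R]_d) i j :
  ((delta_mx i 0 : 'cV[R]_d)^T *m S *m (delta_mx j 0 : 'cV[R]_d)) 0 0 = S i j.
Proof. by rewrite trmx_delta -rowE -colE !mxE. Qed.

Lemma gram_coordK d (S : 'M[R]_d) : S^T = S -> gram_of_coord (gram_coord S) = S.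
Proof.
move=> ST; apply/matrixP => i j; rewrite !mxE !qform_shift//= /qform !qform_delta.
by field.
Qed.

Lemma measurable_qform dd (T : measurableType dd) d (S : T -> 'M[R]_d) (v : 'cV[R]_d) :
  measurable_fun setT S -> measurable_fun setT (fun x => qform (S x) v).
Proof.
move=> mS; have := measurable_mulmx (measurable_mulmx (measurable_cst v^T) mS) (measurable_cst v).
by move=> /measurable_mxP; exact.
Qed.

Lemma measurable_gram_coord dd (T : measurableType dd) d (S : T -> 'M[R]_d) :
  measurable_fun setT S -> measurable_fun setT (fun x => gram_coord (S x)).
Proof.
by move=> mS; apply/measurable_mxP => i j; under eq_fun do rewrite mxE; exact: measurable_qform.
Qed.

Lemma measurable_gram_of_coord d : measurable_fun setT (@gram_of_coord d).
Proof.
apply/measurable_mxP => i j; under eq_fun do rewrite mxE.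
apply: measurable_funM => //; apply: measurable_funB; first apply: measurable_funB.
- exact: measurable_mxentry.
- by apply: measurable_funM => //; exact: measurable_mxentry.
- by apply: measurable_funM => //; exact: measurable_mxentry.
Qed.

Lemma qform_gram (I : Type) (s : seq I) (Q : pred I) d (x : I -> 'cV[R]_d) v :
  qform (\sum_(k <- s | Q k) x k *m (x k)^T) v = \sum_(k <- s | Q k) mxdot v (x k) ^+ 2.
Proof.
rewrite /qform mulmx_sumr mulmx_suml summxE; apply: eq_bigr => k _.
rewrite mxdot_cV mulmxA -mulmxA.
have -> : (x k)^T *m v = (v^T *m x k)^T by rewrite trmx_mul trmxK.
by move: (v^T *m x k) => u; rewrite mxE big_ord1 [u^T _ _]mxE expr2.
Qed.

Lemma gram_sym (I : Type) (s : seq I) (Q : pred I) d (x : I -> 'cV[R]_d) :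
  (\sum_(k <- s | Q k) x k *m (x k)^T)^T = \sum_(k <- s | Q k) x k *m (x k)^T.
Proof. by rewrite raddf_sum/=; apply: eq_bigr => k _; rewrite trmx_mul trmxK. Qed.

Context {d0 : measure_display} {Omega : measurableType d0}.
Variables (P : probability Omega R) (d : nat) (Sigma : 'M[R]_d).
Hypothesis pd : posdef Sigma.
Variable X : 'I_(2 * d + 2) -> Omega -> 'cV[R]_d.
Hypothesis hgauss : forall k, is_gaussian0 P Sigma (X k).
Hypothesis indep : mutually_independent P X.

Let mXt k : measurable_fun setT (fun w => tup_of_cV (X k w)).
Proof. by case: (hgauss k). Qed.

Let mX k : measurable_fun setT (X k).
Proof. exact: measurable_column. Qed.

Definition gram (Q : pred 'I_(2 * d + 2)) (w : Omega) : 'M[R]_d :=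
  \sum_(j | Q j) X j w *m (X j w)^T.

Lemma measurable_gram Q : measurable_fun setT (gram Q).
Proof.
apply/measurable_mxP => i j; rewrite /gram; under eq_fun do rewrite summxE.
under eq_fun do rewrite big_mkcond.
apply: measurable_sum => k; case: (Q k) => //.
by have /measurable_mxP := measurable_mulmx (mX k) (measurable_trmx (mX k)); exact.
Qed.

Let Q1 : pred 'I_(2 * d + 2) := fun j => (j < d)%N.
Let Q2 : pred 'I_(2 * d + 2) := fun j => (d <= j)%N.

Lemma first_block_inj : injective (@first_block d).
Proof. by move=> i j /(congr1 val) /= /val_inj. Qed.

Lemma big_first_block (V : Type) (idx : V) (op : Monoid.law idx) (F : 'I_(2 * d + 2) -> V) :
  \big[op/idx]_(j | Q1 j) F j = \big[op/idx]_(i < d) F (first_block i).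
Proof. exact: (big_ord_narrow (leq_d_2d2 d)). Qed.

Local Notation M := (sample_mx X first_block).

Lemma gram1E w : gram Q1 w = M w *m (M w)^T.
Proof.
rewrite /gram big_first_block; apply/matrixP => i j; rewrite summxE mxE.
by apply: eq_bigr => k _; rewrite !mxE big_ord1 !mxE.
Qed.

Lemma det_gram1 w : \det (gram Q1 w) = \det (M w) ^+ 2.
Proof. by rewrite gram1E det_mulmx det_tr expr2. Qed.

(** The laws are compared in the coordinates [gram_coord], which are nonnegative sums of squares
    over the vectors of the block, so their joint Laplace transform is a product of one weight over
    these vectors. *)
Lemma gram_law (f : 'M[R]_d -> \bar R) : measurable_fun setT f -> (forall S, 0 <= f S)%E ->
  (\int[P]_w ((\det (gram Q1 w))%:E * f (gram Q1 w)) =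
   \int[P]_w ((d`!%:R * \det Sigma)%:E * f (gram Q2 w)))%E.
Proof.
move=> mf f0.
(* An index exists even for d = 0; any one serves to extract the facts on [Phi] and [S]. *)
have k0 : 'I_(2 * d + 2) by apply: (@Ordinal _ 0); rewrite addn2.
have [ig1 eg1] := sample_moment hgauss indep first_block_inj k0 (fun k => tilted1 pd (hgauss k)).
have {}ig1 : P.-integrable setT (EFin \o (fun w => \det (gram Q1 w))).
  by apply: eq_integrable ig1 => // w _; rewrite /= det_gram1 big1 ?mulr1.
(* With the trivial weight, this constant is the mean of a squared determinant. *)
have c0 : 0 <= d`!%:R * \det Sigma.
  have : (0 <= \int[P]_w (\det (M w) ^+ 2 * \prod_j (cst 1 (X (first_block j) w) : R))%:E)%E.
    by apply: integral_ge0 => w _; rewrite lee_fin mulr_ge0 ?sqr_ge0// prodr_ge0.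
  by rewrite eg1 lee_fin expr1n mulr1.
have ig2 : P.-integrable setT (EFin \o (fun w : Omega => d`!%:R * \det Sigma)).
  by apply: (@prob_bounded_integrable _ _ _ P _ (d`!%:R * \det Sigma)) => // w; rewrite ger0_norm.
have g10 w : 0 <= \det (gram Q1 w) by rewrite det_gram1 sqr_ge0.
have -> : (\int[P]_w ((\det (gram Q1 w))%:E * f (gram Q1 w)) =
    \int[P]_w ((\det (gram Q1 w))%:E * (f \o gram_of_coord) (gram_coord (gram Q1 w))))%E.
  by apply: eq_integral => w _ /=; rewrite gram_coordK// gram_sym.
have -> : (\int[P]_w ((d`!%:R * \det Sigma)%:E * f (gram Q2 w)) =
    \int[P]_w ((d`!%:R * \det Sigma)%:E * (f \o gram_of_coord) (gram_coord (gram Q2 w))))%E.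
  by apply: eq_integral => w _ /=; rewrite gram_coordK// gram_sym.
apply: eq_wlaw_box => //.
- exact/measurable_gram_coord/measurable_gram.
- exact/measurable_gram_coord/measurable_gram.
- move=> b.
  pose u Q (p : 'I_d * 'I_d) w := qform (gram Q w) (pair_dir p).
  have mu Q p : measurable_fun setT (u Q p) by exact/measurable_qform/measurable_gram.
  have u0 Q p w : 0 <= u Q p w.
    by rewrite /u /gram qform_gram sumr_ge0// => k _; exact: sqr_ge0.
  have := @eq_laplace_multi _ _ _ _ _ P P _ (u Q1) (u Q2) (mu _) (mu _) (u0 _) (u0 _)
    (index_enum _) _ _ (index_enum_uniq _) ig1 ig2.
  move=> /(_ _ b) lap.
  transitivity (\int[P]_x (\det (gram Q1 x) * \prod_i (u Q1 i x <= b i)%R%:R)%:E)%E.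
    by apply: eq_integral => w _; congr ((_ * _)%:E); apply: eq_bigr => -[i j] _; rewrite mxE.
  rewrite lap; last first.
    move=> t t0.
    have [Phi [S tS]] := tilted_family pd hgauss (index_enum _) (@pair_dir d) t0.
    set h := (fun x => _) in tS.
    (* Exchanging the products over directions and over vectors groups the Laplace kernel into the
       tilting weight of each vector. *)
    have hE Q w : \prod_p expR (- (t p * u Q p w)) = \prod_(k | Q k) h (X k w).
      rewrite /h exchange_big/=; apply: eq_bigr => p _.
      rewrite -expR_sum; congr expR; rewrite /u /gram qform_gram mulr_sumr.
      by rewrite sumrN.
    have [_ e1] := sample_moment hgauss indep first_block_inj k0 tS.
    transitivity ((d`!%:R * \det Sigma * Phi ^+ (d + 2))%:E).
      rewrite -e1; apply: eq_integral => w _; congr EFin.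
      by rewrite det_gram1 hE big_first_block.
    have P0 : 0 < Phi by exact: tilted_gt0 (tS k0).
    have hn x : `|h x| <= 1 by exact: tilted_norm (tS k0).
    have ih k : P.-integrable setT (fun w => (h (X k w))%:E).
      apply: (@prob_bounded_integrable _ _ _ P (h \o X k) 1) => [|w]; last exact: hn.
      exact: (measurableT_comp (tilted_meas (tS k)) (mX k)).
    have uf : uniq [seq id k | k <- [seq k <- index_enum _ | Q2 k]].
      by rewrite map_id filter_uniq// index_enum_uniq.
    have [i2 e2] := @indep_prod _ _ _ P d _ X mXt indep _ _
      id (fun=> h) (fun=> Phi) uf (fun=> tilted_meas (tS k0)) ih (fun k => tilted_int (tS k)).
    under [RHS]eq_integral do rewrite hE -big_filter EFinM.
    rewrite integralZl// e2 -EFinM; congr ((_ * _)%:E); rewrite big_filter.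
    (* The d + 2 vectors of the second block are counted by cancelling the first d factors from
       [Phi ^+ (2 * d + 2)]. *)
    have : \prod_(k < 2 * d + 2) Phi = Phi ^+ d * \prod_(k < 2 * d + 2 | Q2 k) Phi.
      rewrite (bigID Q1)/= big_first_block prodr_const card_ord; congr (_ * _).
      by apply: eq_bigl => k; rewrite /Q1 /Q2 -leqNgt.
    have e22 : (2 * d + 2 = d + (d + 2))%N by rewrite mul2n -addnn addnA.
    rewrite prodr_const card_ord [X in Phi ^+ X]e22 exprD => /mulfI; apply.
    by rewrite expf_neq0// gt_eqF.
  by apply: eq_integral => w _; congr ((_ * _)%:E); apply: eq_bigr => -[i j] _; rewrite mxE.
- by apply: measurableT_comp => //; exact: measurable_gram_of_coord.
- by move=> U; exact: f0.
Qed.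

End gram_law.

(** * The orthogonal factor *)

Section orthogonal_factor.
Context {R : realType}.

Lemma chol_spec_unitmx d (A L : 'M[R]_d) : chol_spec A L -> L \in unitmx.
Proof.
case=> tL pL _; rewrite unitmxE unitfE det_trig; last exact/is_trig_mxP.
by apply/prodf_neq0 => i _; rewrite gt_eqF ?pL.
Qed.

Lemma posdef_unitmx d (A : 'M[R]_d) : posdef A -> A \in unitmx.
Proof.
move=> /chol_posdef hL; have uL := chol_spec_unitmx hL; have [_ _ <-] := hL.
by rewrite unitmx_mul unitmx_tr uL.
Qed.

Lemma posdef_gram d (x : 'M[R]_d) : \det x != 0 -> posdef (x *m x^T).
Proof.
move=> dx; split; first by rewrite trmx_mul trmxK.
move=> v v0; set y := x^T *m v.
have -> : v^T *m (x *m x^T) *m v = y^T *m y by rewrite /y trmx_mul trmxK !mulmxA.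
have y0 : y != 0.
  apply: contra_neq v0 => y0.
  have ux : x^T \in unitmx by rewrite unitmx_tr unitmxE unitfE.
  by rewrite -[v](mulKmx ux) -/y y0 mulmx0.
rewrite mxE lt_def sumr_ge0 ?andbT => [|i _]; last by rewrite mxE -expr2 sqr_ge0.
apply: contra_neq y0 => s0; apply/matrixP => i j; rewrite (ord1 j) [RHS]mxE.
have /(_ i) : forall i : 'I_d, y^T 0 i * y i 0 = 0.
  move=> k; apply/eqP; move/eqP : s0; rewrite psumr_eq0 => [/allP|l _].
    by move=> /(_ k); apply; rewrite mem_index_enum.
  by rewrite mxE -expr2 sqr_ge0.
by rewrite [y^T _ _]mxE -expr2 => /eqP; rewrite sqrf_eq0 => /eqP.
Qed.

(** The value 1 on singular matrices makes the factor orthogonal everywhere, so it can itself serve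
    as the rotation in the invariance identities at every outcome. *)
Definition orth_factor {d} (x : 'M[R]_d) : 'M[R]_d :=
  if \det x == 0 then 1%:M else invmx (chol (x *m x^T)) *m x.

Lemma orth_factor_mul d (x : 'M[R]_d) : \det x != 0 ->
  chol (x *m x^T) *m orth_factor x = x.
Proof.
move=> dx; rewrite /orth_factor (negbTE dx) mulKVmx//.
exact/chol_spec_unitmx/chol_posdef/posdef_gram.
Qed.

Lemma orth_factorP d (x : 'M[R]_d) : orth_factor x *m (orth_factor x)^T = 1%:M.
Proof.
rewrite /orth_factor; case: (eqVneq (\det x) 0) => [_|dx]; first by rewrite trmx1 mulmx1.
have hL := chol_posdef (posdef_gram dx); have uL := chol_spec_unitmx hL.
case: hL => _ _; move: (chol _) uL => L uL e.
rewrite trmx_mul mulmxA -[_ *m x *m x^T]mulmxA -e trmx_inv mulKmx// mulmxV//.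
by rewrite unitmx_tr.
Qed.

Lemma orth_det_neq0 d (U : 'M[R]_d) : U *m U^T = 1%:M -> \det U != 0.
Proof. by move=> /mulmx1_unit[]; rewrite unitmxE unitfE. Qed.

Lemma orth_gram d (x U : 'M[R]_d) : U *m U^T = 1%:M -> (x *m U) *m (x *m U)^T = x *m x^T.
Proof. by move=> UU; rewrite trmx_mul mulmxA -(mulmxA x) UU mulmx1. Qed.

(** Right rotation keeps the Gram matrix, hence its Cholesky factor. *)
Lemma orth_factorM d (x U : 'M[R]_d) : \det x != 0 -> U *m U^T = 1%:M ->
  orth_factor (x *m U) = orth_factor x *m U.
Proof.
move=> dx UU; rewrite /orth_factor det_mulmx mulf_eq0 (negbTE dx) (negbTE (orth_det_neq0 UU))/=.
by rewrite orth_gram// mulmxA.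
Qed.

Lemma measurable_orth_factor d : measurable_fun setT (@orth_factor d).
Proof.
have mi : measurable_fun setT (fun x : 'M[R]_d => x) by exact: measurable_id.
have mdet : measurable_fun setT (fun x : 'M[R]_d => \det x) by exact: measurable_det.
have -> : @orth_factor d = fun x => if x \in [set x : 'M[R]_d | \det x = 0] then 1%:M else
    invmx (chol (x *m x^T)) *m x.
  apply/funext => x; rewrite /orth_factor; case: eqP => h; first by rewrite mem_set.
  by rewrite memNset.
apply: measurable_if_set => //.
  by rewrite -[X in measurable X]setTI; exact: (mdet measurableT [set 0]).
apply: measurable_mulmx => //; apply: measurable_invmx.
apply: (measurableT_comp (@measurable_chol R d)).
by apply: measurable_mulmx => //; exact: measurable_trmx.
Qed.

Context {d0 : measure_display} {Omega : measurableType d0}.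
Variables (P : probability Omega R) (d : nat) (M : Omega -> 'M[R]_d).
Hypothesis mM : measurable_fun setT M.
Hypothesis M_neq0 : {ae P, forall w, \det (M w) != 0}.
Hypothesis M_rinv : forall U : 'M[R]_d, U *m U^T = 1%:M ->
  forall f : 'M[R]_d -> \bar R, measurable_fun setT f -> (forall x, 0 <= f x)%E ->
  (\int[P]_w f (M w *m U) = \int[P]_w f (M w))%E.

Let S w := M w *m (M w)^T.
Let Q w := orth_factor (M w).

Let mS : measurable_fun setT S.
Proof. by apply: measurable_mulmx => //; exact: measurable_trmx. Qed.

Let mQ : measurable_fun setT Q.
Proof. exact: (measurableT_comp (@measurable_orth_factor d) mM). Qed.

Let QQ w : Q w *m (Q w)^T = 1%:M. Proof. exact: orth_factorP. Qed.
Let QtQ w : (Q w)^T *m ((Q w)^T)^T = 1%:M.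
Proof. by rewrite trmxK; apply: mulmx1C; exact: QQ. Qed.

Section pair.
Variable F : 'M[R]_d * 'M[R]_d -> \bar R.
Hypothesis mF : measurable_fun setT F.
Hypothesis F0 : forall z, (0 <= F z)%E.

Lemma orth_factor_rinv U : U *m U^T = 1%:M ->
  (\int[P]_w F (S w, Q w *m U) = \int[P]_w F (S w, Q w))%E.
Proof.
move=> UU.
have mi : measurable_fun setT (fun x : 'M[R]_d => x) by exact: measurable_id.
have mg : measurable_fun setT (fun x : 'M[R]_d => F (x *m x^T, orth_factor x)).
  apply: (measurableT_comp mF); apply: measurable_fun_pair; last exact: measurable_orth_factor.
  by apply: measurable_mulmx => //; exact: measurable_trmx.
rewrite -(M_rinv UU mg)//; apply: ge0_ae_eq_integral => //.
- apply: (measurableT_comp mF); apply: measurable_fun_pair => //.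
  by apply: measurable_mulmx.
- apply: (measurableT_comp mg); exact: measurable_mulmx.
by apply: filterS M_neq0 => w dw _; rewrite orth_factorM// orth_gram.
Qed.

End pair.

(** Average g (Q Q'^T) over two independent copies. With Q' fixed, right invariance removes Q'^T and
    gives the mean of g (Q). With Q fixed, the transpose Q' Q^T has the law of Q', and the mean is
    that of g (Q^T). *)
Lemma orth_factor_tr (g : 'M[R]_d -> \bar R) : measurable_fun setT g ->
  (forall x, 0 <= g x)%E -> (\int[P]_w g (Q w) = \int[P]_w g (Q w)^T)%E.
Proof.
move=> mg g0.
transitivity (\int[P]_w' \int[P]_w g (Q w *m (Q w')^T))%E.
  rewrite -[LHS]mule1 -(probability_setT P) -integral_cst//.
  apply: eq_integral => w' _.
  have mF : measurable_fun setT (fun z : 'M[R]_d * 'M[R]_d => g z.2).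
    by apply: measurableT_comp.
  by have := orth_factor_rinv mF (fun=> g0 _) (QtQ w') => /= ->.
rewrite (@fubini_tonelli _ _ _ _ _ P P (fun z => g (Q z.2 *m (Q z.1)^T)))//=; last first.
  apply: (measurableT_comp mg); apply: measurable_mulmx; first exact: (measurableT_comp mQ).
  by apply: measurable_trmx; exact: (measurableT_comp mQ).
transitivity (\int[P]_y \int[P]_x g (Q x)^T)%E; last first.
  rewrite -[RHS]mule1 -(probability_setT P) -integral_cst//.
apply: eq_integral => y _.
have mF : measurable_fun setT (fun z : 'M[R]_d * 'M[R]_d => g z.2^T).
  by apply: (measurableT_comp mg); apply: measurable_trmx.
have := orth_factor_rinv mF (fun=> g0 _) (QtQ y) => /= <-.
by apply: eq_integral => x _; rewrite trmx_mul trmxK.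
Qed.

Lemma orth_factor_linv (g : 'M[R]_d -> \bar R) V : measurable_fun setT g ->
  (forall x, 0 <= g x)%E -> V *m V^T = 1%:M ->
  (\int[P]_w g (V *m Q w) = \int[P]_w g (Q w))%E.
Proof.
move=> mg g0 VV.
have mi : measurable_fun setT (fun x : 'M[R]_d => x) by exact: measurable_id.
have mgV : measurable_fun setT (fun x => g (V *m x)).
  by apply: (measurableT_comp mg); exact: measurable_mulmx.
rewrite (orth_factor_tr mgV)// [RHS]orth_factor_tr//.
have mF : measurable_fun setT (fun z : 'M[R]_d * 'M[R]_d => g z.2^T).
  by apply: (measurableT_comp mg); apply: measurable_trmx.
have VtV : V^T *m V^T^T = 1%:M by rewrite trmxK; apply: mulmx1C.
have := orth_factor_rinv mF (fun=> g0 _) VtV => /= <-.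
by apply: eq_integral => w _; rewrite trmx_mul trmxK.
Qed.

(** Multiply Q on the right by an independent copy Q', which changes nothing jointly with S; then
    fix Q and S and remove Q from Q Q' by left invariance, leaving S and an independent Q'. *)
Lemma orth_factor_indep (F : 'M[R]_d * 'M[R]_d -> \bar R) : measurable_fun setT F ->
  (forall z, 0 <= F z)%E ->
  (\int[P]_w F (S w, Q w) = \int[P]_w \int[P]_w' F (S w, Q w'))%E.
Proof.
move=> mF F0.
transitivity (\int[P]_w' \int[P]_w F (S w, Q w *m Q w'))%E.
  rewrite -[LHS]mule1 -(probability_setT P) -integral_cst//.
  by apply: eq_integral => w' _; rewrite (orth_factor_rinv mF F0 (QQ w')).
rewrite (@fubini_tonelli _ _ _ _ _ P P (fun z => F (S z.2, Q z.2 *m Q z.1)))//=; last first.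
  apply: (measurableT_comp mF); apply: measurable_fun_pair; first exact: (measurableT_comp mS).
  by apply: measurable_mulmx; exact: (measurableT_comp mQ).
apply: eq_integral => w _.
by rewrite (orth_factor_linv (g := fun x => F (S w, x)))//; exact: measurableT_comp.
Qed.

End orthogonal_factor.

(** * Almost sure invertibility of a Gaussian matrix *)

Lemma finite_roots {R : realType} (p : {poly R}) : p != 0 -> finite_set [set x | root p x].
Proof.
move=> p0; apply: contrapT => /(@infinite_set_fset _ _ (size p))[B Bp].
apply/negP; rewrite -ltnNge; apply: max_poly_roots p0 _ (finmap.fset_uniq B).
by apply/allP => x xB; exact: Bp.
Qed.

(** The singular shifts are roots of the characteristic polynomial of - B, which is monic and so
    nonzero. *)
Lemma finite_det_shift {R : realType} d (B : 'M[R]_d) :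
  finite_set [set s | \det (B + s *: 1%:M) = 0].
Proof.
apply: (@sub_finite_set _ _ [set s | root (char_poly (- B)) s]); last first.
  by apply: finite_roots; exact: monic_neq0 (char_poly_monic _).
move=> s /= ds; rewrite /root; apply/eqP; rewrite -[RHS]ds.
rewrite /char_poly -[LHS]/(horner_eval s _) -det_map_mx; congr (\det _).
apply/matrixP => i j; rewrite !mxE /= /horner_eval hornerD hornerN hornerMn hornerX hornerC.
by rewrite opprK addrC mulr_natr.
Qed.

Lemma normal_prob_finite {R : realType} (m s : R) (A : set R) : finite_set A ->
  measurable A /\ normal_prob m s A = 0.
Proof.
move=> fA; have cA := finite_set_countable fA.
have mA : measurable A by apply: countable_measurable.
split => //; have /null_content_dominatesP := normal_prob_dominates m s; apply => //.
exact: countable_lebesgue_measure0.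
Qed.

Section gaussian_matrix.
Context {R : realType} {d0 : measure_display} {Omega : measurableType d0}.
Variables (P : probability Omega R) (d : nat) (Sigma : 'M[R]_d).
Hypothesis pd : posdef Sigma.

(** The variance of [mxdot A M] when the columns of M are independent of covariance [Sigma]. *)
Definition mx_qform (A : 'M[R]_d) : R := \tr (A^T *m Sigma *m A).

Lemma mx_qformE A : mx_qform A = \sum_i qform Sigma (col i A).
Proof.
apply: eq_bigr => i _; rewrite /qform tr_col -row_mul !mxE.
by apply: eq_bigr => k _; rewrite !mxE.
Qed.

Lemma mxdot_col m n (A B : 'M[R]_(m, n)) : mxdot A B = \sum_i mxdot (col i A) (col i B).
Proof.
apply: eq_bigr => i _; rewrite mxdot_cV !mxE.
by apply: eq_bigr => k _; rewrite !mxE.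
Qed.

Lemma gaussian_sample_charfn n (X : 'I_n -> Omega -> 'cV[R]_d) (phi : 'I_d -> 'I_n) :
  (forall k, is_gaussian0 P Sigma (X k)) -> mutually_independent P X -> injective phi ->
  forall A c, (\int[P]_w (cos (mxdot A (sample_mx X phi w) + c))%:E =
    (expR (- (mx_qform A / 2)) * cos c)%:E)%E.
Proof.
move=> gX indep inj A c.
have mXt k : measurable_fun setT (fun w => tup_of_cV (X k w)) by case: (gX k).
have := @indep_charfn _ _ _ P d n X mXt indep 'I_d (index_enum _) phi (fun i => col i A)
  (fun i => qform Sigma (col i A) / 2) _ _ c.
rewrite mx_qformE mulr_suml => <-; last 2 first.
- by rewrite map_inj_uniq ?index_enum_uniq.
- by move=> i c'; exact: gaussian_charfn.
apply: eq_integral => w _; rewrite mxdot_col; congr (cos (_ + _))%:E; apply: eq_bigr => i _.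
by congr mxdot; apply/matrixP => k l; rewrite (ord1 l) !mxE.
Qed.

Variable M : Omega -> 'M[R]_d.
Hypothesis mM : measurable_fun setT M.
Hypothesis M_charfn : forall A c, (\int[P]_w (cos (mxdot A (M w) + c))%:E =
    (expR (- (mx_qform A / 2)) * cos c)%:E)%E.

(** Cyclicity of the trace gives [A *m U^T] and [A] the same variance, hence the same characteristic
    function. *)
Lemma gaussian_mx_rinv U : U *m U^T = 1%:M ->
  forall f : 'M[R]_d -> \bar R, measurable_fun setT f -> (forall x, 0 <= f x)%E ->
  (\int[P]_w f (M w *m U) = \int[P]_w f (M w))%E.
Proof.
move=> UU; apply: charfn_law_unique => //; first exact: measurable_mulmx.
move=> A c; have E w : mxdot A (M w *m U) = mxdot (A *m U^T) (M w).
  by rewrite /mxdot trmx_mul trmxK mulmxA mxtrace_mulC mulmxA.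
under eq_integral do rewrite E.
rewrite !M_charfn /mx_qform trmx_mul trmxK -!mulmxA mxtrace_mulC -!mulmxA.
by rewrite (mulmx1C UU) mulmx1.
Qed.

(* Replacing the component of M along the identity by an independent normal variable does not
   change its law, and for a fixed matrix B only finitely many B + s 1 are singular. *)
Lemma gaussian_mx_det_neq0 : {ae P, forall w, \det (M w) != 0}.
Proof.
(* The variable [mxdot K M] has covariance tr A with [mxdot A M] and variance [kap]. Subtracting e
   times it along the identity lowers the variance of [mxdot A M] by (2e - e^2 kap) (tr A)^2, which
   the fresh term r y restores. The value of e keeps r^2 positive. *)
pose K := invmx Sigma; pose kap := \tr K; pose e := (1 + `|kap|)^-1.
pose r := Num.sqrt (2 * e - e ^+ 2 * kap).
have uS := posdef_unitmx pd.
have KT : K^T = K by rewrite /K trmx_inv; case: pd => ->.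
have SK : Sigma *m K = 1%:M by exact: mulmxV.
have KS : K *m Sigma = 1%:M by exact: mulVmx.
have k1 : 0 < 1 + `|kap| by rewrite ltr_wpDr.
have e0 : 0 < e by rewrite invr_gt0.
have r0 : 0 < 2 * e - e ^+ 2 * kap.
  have -> : 2 * e - e ^+ 2 * kap = e ^+ 2 * (2 * (1 + `|kap|) - kap).
    rewrite /e; field; exact: lt0r_neq0.
  rewrite mulr_gt0 ?exprn_gt0// subr_gt0; have := ler_norm kap; have := normr_ge0 kap; lra.
have rr : r ^+ 2 = 2 * e - e ^+ 2 * kap by rewrite sqr_sqrtr// ltW.
pose M2 (z : Omega * measurableTypeR R) : 'M[R]_d :=
  M z.1 + (r * z.2 - e * mxdot K (M z.1)) *: 1%:M.
have m1 : measurable_fun setT (fun z : Omega * measurableTypeR R => M z.1).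
  exact: (measurableT_comp mM).
have m2 : measurable_fun setT (fun z : Omega * measurableTypeR R => z.2 : R).
  exact: measurable_snd.
have mM2 : measurable_fun setT M2.
  apply/measurable_mxP => i j; under eq_fun do rewrite !mxE.
  apply: measurable_funD; first by move/measurable_mxP : m1; exact.
  apply: measurable_funM => //; apply: measurable_funB; apply: measurable_funM => //.
  exact: measurable_mxdot.
have M2dot A z : mxdot A (M2 z) = r * \tr A * z.2 + mxdot (A + (- (e * \tr A)) *: K) (M z.1).
  rewrite mxdotDl mxdotZl {1}/mxdot mulmxDr -scalemxAr mulmx1 mxtraceD mxtraceZ mxtrace_tr -/(mxdot _ _).
  ring.
have qM2 A : mx_qform (A + (- (e * \tr A)) *: K) = mx_qform A - (r * \tr A) ^+ 2.
  have trE a : (A + a *: K)^T = A^T + a *: K.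
    by rewrite -{2}KT; apply/matrixP => i j; rewrite !mxE.
  rewrite /mx_qform trE !mulmxDl !mulmxDr.
  rewrite -!scalemxAl -!scalemxAr KS !mul1mx -(mulmxA A^T Sigma K) SK mulmx1.
  rewrite !mxtraceD !mxtraceZ mxtrace_tr.
  rewrite -/kap exprMn rr; ring.
have law f : measurable_fun setT f -> (forall x, 0 <= f x)%E ->
    (\int[P]_w f (M w) = \int[P \x normal_prob 0 1]_z f (M2 z))%E.
  apply: charfn_law_unique => // A c; rewrite M_charfn.
  have mc : measurable_fun setT (fun z => cos (mxdot A (M2 z) + c)).
    under eq_fun do rewrite -[X in X + c]mul1r.
    by apply: measurable_cos_affine; exact: measurable_mxdot.
  rewrite -integral12_prod_meas1; last first.
    by apply: prod_bounded_integrable mc _ => z; exact: norm_cos_le1.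
  have inner w : (\int[normal_prob 0 1]_y (cos (mxdot A (M2 (w, y)) + c))%:E =
      (expR (- (r * \tr A * 1) ^+ 2 / 2))%:E * (cos (mxdot (A + (- (e * \tr A)) *: K) (M w) + c))%:E)%E.
    rewrite -EFinM -normal_charfn ?oner_neq0//.
    by apply: eq_integral => y _; rewrite M2dot -addrA.
  rewrite /fubini_F /= (eq_integral _ _ (fun w _ => inner w)).
  rewrite integralZl//; last first.
    apply: (@prob_bounded_integrable _ _ _ P _ 1) => [|w]; last exact: norm_cos_le1.
    under eq_fun do rewrite -[X in X + c]mul1r.
    by apply: measurable_cos_affine; exact: measurable_mxdot.
  by rewrite M_charfn -EFinM mulrA -expRD qM2; congr (expR _ * _)%:E; field.
have mD : measurable [set x : 'M[R]_d | \det x = 0].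
  have mdet : measurable_fun setT (fun x : 'M[R]_d => \det x).
    by apply: measurable_det; exact: measurable_id.
  by rewrite -[X in measurable X]setTI; exact: (mdet measurableT [set 0]).
have mf : measurable_fun setT (fun x => (\1_[set x : 'M[R]_d | \det x = 0] x)%:E : \bar R).
  exact/measurable_EFinP/measurable_indic.
have mdM : measurable [set w | \det (M w) = 0].
  by rewrite -[X in measurable X]setTI; exact: (mM measurableT mD).
exists [set w | \det (M w) = 0]; split => //; last by move=> w /= /negP; rewrite negbK => /eqP.
have -> : P [set w | \det (M w) = 0] =
    (\int[P]_w (\1_[set x : 'M[R]_d | \det x = 0] (M w))%:E)%E.
  by rewrite -[in LHS](setIT [set w | _]) -integral_indic.
rewrite (law _ mf); last by move=> x; rewrite lee_fin.
rewrite fubini_tonelli1//; last exact: (measurableT_comp mf mM2).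
rewrite /fubini_F integral0_eq// => w _ /=.
pose B := [set y : R | \det (M w + (r * y - e * mxdot K (M w)) *: 1%:M) = 0].
(* As r is nonzero, y determines the shift injectively, so finitely many singular shifts leave
   finitely many y, a null set for the normal law. *)
have fB : finite_set B.
  suff : finite_set ((fun y => r * y - e * mxdot K (M w)) @^-1`
    [set s | \det (M w + s *: 1%:M) = 0]) by [].
  apply: finite_preimage; last exact: finite_det_shift.
  move=> x y _ _ /addIr /mulfI; apply; rewrite gt_eqF// sqrtr_gt0//.
have [mB B0] := normal_prob_finite 0 1 fB.
rewrite (_ : (\int[_]_y _)%E = \int[normal_prob 0 1]_y (\1_B y)%:E)%E//.
by rewrite integral_indic// setIT.
Qed.

End gaussian_matrix.

(** * Volume sampling *)

Section volume_sampling.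
Context {R : realType} {d0 : measure_display} {Omega : measurableType d0}.
Variables (P : probability Omega R) (d : nat) (Sigma : 'M[R]_d).
Hypothesis pd : posdef Sigma.
Variable X : 'I_(2 * d + 2) -> Omega -> 'cV[R]_d.
Hypothesis hgauss : forall k, is_gaussian0 P Sigma (X k).
Hypothesis indep : mutually_independent P X.

Let mXt k : measurable_fun setT (fun w => tup_of_cV (X k w)).
Proof. by case: (hgauss k). Qed.

Let Q1 : pred 'I_(2 * d + 2) := fun j => (j < d)%N.
Let Q2 : pred 'I_(2 * d + 2) := fun j => (d <= j)%N.
Local Notation M := (sample_mx X first_block).

Lemma measurable_sample : measurable_fun setT M.
Proof.
apply/measurable_mxP => i j; under eq_fun do rewrite mxE.
by have /measurable_mxP := measurable_column mXt (first_block j); exact.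
Qed.

Let M_charfn := gaussian_sample_charfn pd hgauss indep (@first_block_inj d).

Lemma sample_det_neq0 : {ae P, forall w, \det (M w) != 0}.
Proof. exact: (gaussian_mx_det_neq0 pd measurable_sample M_charfn). Qed.

Variable f : 'M[R]_d -> \bar R.
Hypothesis mf : measurable_fun setT f.
Hypothesis f0 : forall x, (0 <= f x)%E.

Let mfc dd (T : measurableType dd) (S Q : T -> 'M[R]_d) : measurable_fun setT S ->
  measurable_fun setT Q -> measurable_fun setT (fun z => f (chol (S z) *m Q z)).
Proof.
move=> mS mQ; apply: (measurableT_comp mf); apply: measurable_mulmx => //.
exact: (measurableT_comp (@measurable_chol R d)).
Qed.

Let mQ : measurable_fun setT (fun w => orth_factor (M w)).
Proof. exact: (measurableT_comp (@measurable_orth_factor R d) measurable_sample). Qed.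

(** Resampling all columns outside the first block: the Gram matrix then depends only on the second
    copy and the orthogonal factor only on the first. *)
Lemma second_block_resample :
  (\int[P]_w f (chol (gram X Q2 w) *m orth_factor (M w)) =
   \int[P]_w' \int[P]_w f (chol (gram X Q2 w') *m orth_factor (M w)))%E.
Proof.
pose G2 (N : 'M[R]_(d, 2 * d + 2)) := \sum_(j | Q2 j) col j N *m (col j N)^T.
pose N1 (N : 'M[R]_(d, 2 * d + 2)) : 'M[R]_d := \matrix_(i, j) N i (first_block j).
pose G N := f (chol (G2 N) *m orth_factor (N1 N)).
have mi : measurable_fun setT (fun N : 'M[R]_(d, 2 * d + 2) => N) by exact: measurable_id.
have mcol j : measurable_fun setT (fun N : 'M[R]_(d, 2 * d + 2) => col j N).
  apply/measurable_mxP => i k; under eq_fun do rewrite mxE; exact: measurable_mxentry.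
have mG : measurable_fun setT G.
  apply: mfc.
    apply/measurable_mxP => i j; rewrite /G2; under eq_fun do rewrite summxE big_mkcond.
    apply: measurable_sum => k; case: (Q2 k) => //.
    by have /measurable_mxP := measurable_mulmx (mcol k) (measurable_trmx (mcol k)); exact.
  apply: (measurableT_comp (@measurable_orth_factor R d)); apply/measurable_mxP => i j.
  by under eq_fun do rewrite mxE; exact: measurable_mxentry.
have colE j w : col j (columns X w) = X j w.
  by apply/matrixP => i k; rewrite (ord1 k) !mxE.
transitivity (\int[P]_w G (columns X w))%E.
  apply: eq_integral => w _; congr (f (chol _ *m orth_factor _)).
    by apply: eq_bigr => j _; rewrite colE.
  by apply/matrixP => i j; rewrite !mxE.
rewrite (ge0_resample mXt indep Q1 mG); last by move=> N; exact: f0.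
transitivity (\int[P \x P]_z f (chol (gram X Q2 z.2) *m orth_factor (M z.1)))%E.
  apply: eq_integral => z _; congr (f (chol _ *m orth_factor _)).
    apply: eq_bigr => j; rewrite /Q2 leqNgt => /negbTE jd.
    have -> // : col j (mx_glue Q1 (columns X z.1) (columns X z.2)) = X j z.2.
    by apply/matrixP => i k; rewrite (ord1 k) !mxE /Q1 jd.
  by apply/matrixP => i j; rewrite !mxE /Q1 /= ltn_ord.
rewrite fubini_tonelli2//; apply: mfc; last exact: (measurableT_comp mQ).
exact: (measurableT_comp (measurable_gram hgauss Q2)).
Qed.

Lemma volume_sampling_law :
  ((d`!%:R * \det Sigma)%:E * \int[P]_w f (chol (gram X Q2 w) *m orth_factor (M w)) =
   \int[P]_w ((\det (gram X Q1 w))%:E * f (M w)))%E.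
Proof.
have c0 : 0 <= d`!%:R * \det Sigma.
  rewrite mulr_ge0//; case: (chol_posdef pd) => _ _ <-.
  by rewrite det_mulmx det_tr -expr2 sqr_ge0.
(* Averaging over the orthogonal factor first leaves a function of the Gram matrix alone, to which
   [gram_law] applies. *)
pose phi S := (\int[P]_w f (chol S *m orth_factor (M w)))%E.
have phi0 S : (0 <= phi S)%E by exact: integral_ge0.
have mphi : measurable_fun setT phi.
  apply: (@measurable_fun_fubini_tonelli_F _ _ _ _ _ P
    (fun z : 'M[R]_d * Omega => f (chol z.1 *m orth_factor (M z.2)))) => //.
  by apply: mfc => //; exact: (measurableT_comp mQ).
have mg1 := measurable_gram hgauss Q1; have mg2 := measurable_gram hgauss Q2.
have mM := measurable_sample.
have -> : (\int[P]_w f (chol (gram X Q2 w) *m orth_factor (M w)) =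
    \int[P]_w phi (gram X Q2 w))%E := second_block_resample.
rewrite -ge0_integralZl//; last exact: (measurableT_comp mphi).
rewrite -(gram_law pd hgauss indep mphi phi0).
(* The absolute value makes the function nonnegative on all pairs of matrices; on Gram matrices it
   changes nothing. *)
have mF : measurable_fun setT (fun z : 'M[R]_d * 'M[R]_d => (`|\det z.1|%:E * f (chol z.1 *m z.2))%E).
  apply: emeasurable_funM; last exact: mfc.
  apply/measurable_EFinP; apply: measurableT_comp => //; exact: measurable_det.
have F0 (z : 'M[R]_d * 'M[R]_d) : (0 <= `|\det z.1|%:E * f (chol z.1 *m z.2))%E by rewrite mule_ge0.
have dg w : `|\det (gram X Q1 w)| = \det (gram X Q1 w) by rewrite det_gram1 ger0_norm ?sqr_ge0.
have := orth_factor_indep mM sample_det_neq0 (gaussian_mx_rinv mM M_charfn) mF F0.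
rewrite /= => oi.
transitivity (\int[P]_w \int[P]_w' (`|\det (M w *m (M w)^T)|%:E *
    f (chol (M w *m (M w)^T) *m orth_factor (M w'))))%E.
  apply: eq_integral => w _; rewrite -[in RHS]gram1E dg -ge0_integralZl//.
  - exact: mfc.
  - by rewrite lee_fin det_gram1 sqr_ge0.
rewrite -oi; apply: ge0_ae_eq_integral => //.
- apply: emeasurable_funM; last first.
    by apply: mfc => //; apply: measurable_mulmx => //; exact: measurable_trmx.
  apply/measurable_EFinP; apply: measurableT_comp => //; apply: measurable_det.
  by apply: measurable_mulmx => //; exact: measurable_trmx.
- by apply: emeasurable_funM; [exact/measurable_EFinP/measurable_det|exact: (measurableT_comp mf)].
- by move=> w _; exact: mule_ge0.
- by move=> w _; apply: mule_ge0 => //; rewrite lee_fin det_gram1 sqr_ge0.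
by apply: filterS sample_det_neq0 => w dw _; rewrite -[in LHS]gram1E dg gram1E orth_factor_mul.
Qed.

End volume_sampling.

Definition mx_tuple {R : realType} {d : nat} (N : 'M[R]_d) : d.-tuple (d.-tuple R) :=
  [tuple tup_of_cV (col j N) | j < d].

Lemma measurable_mx_tuple {R : realType} d : measurable_fun setT (@mx_tuple R d).
Proof.
apply/measurable_fun_tnthP => j; rewrite /comp.
under eq_fun do rewrite tnth_mktuple.
apply/measurable_fun_tnthP => i; rewrite /comp.
by under eq_fun do rewrite tnth_mktuple mxE; exact: measurable_mxentry.
Qed.

(* Indices are 0-based: x_1..x_{2d+2} are X 0 .. X (2d+1); the first block
   j = 1..d is {j < d}, the second block j = d+1..2d+2 is {d <= j}. *)
Theorem theorem4 (R : realType) (d0 : measure_display)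
  (Omega : measurableType d0) (P : probability Omega R)
  (d : nat) (Sigma : 'M[R]_d) (hSigma : posdef Sigma)
  (X : 'I_(2 * d + 2) -> Omega -> 'cV[R]_d)
  (hgauss : forall k, is_gaussian0 P Sigma (X k))
  (hindep : mutually_independent P X) :
  let x := fun (i : 'I_d) w => X (first_block i) w in
  let S1 := fun w => \sum_(j < 2 * d + 2 | (j < d)%N) X j w *m (X j w)^T in
  let S2 := fun w => \sum_(j < 2 * d + 2 | (d <= j)%N) X j w *m (X j w)^T in
  let xt := fun w : Omega =>
    [tuple tup_of_cV (msqrt (S2 w) *m minvsqrt (S1 w) *m x i w) | i < d] in
  let xs := fun w : Omega => [tuple tup_of_cV (x i w) | i < d] in
  (* VS^d_{D_X}(A) = E_{D_X^d}[1_A det(sum_i x_i x_i^T)] / (d! det Sigma),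
     where (x_1,...,x_d) ~ D_X^d *)
  let VS := fun A : set (d.-tuple (d.-tuple R)) =>
    ((\int[P]_w (\1_A (xs w) * \det (S1 w))%:E) *
     ((d`!%:R * \det Sigma)^-1)%:E)%E in
  forall A : set (d.-tuple (d.-tuple R)), measurable A ->
    P (xt @^-1` A) = VS A.
Proof.
move=> x S1 S2 xt xs VS A mA.
pose M := sample_mx X first_block.
pose f (N : 'M[R]_d) : \bar R := (\1_A (mx_tuple N))%:E.
have mf : measurable_fun setT f.
  apply/measurable_EFinP; apply: measurableT_comp; last exact: measurable_mx_tuple.
  exact: measurable_indic.
have f0 N : (0 <= f N)%E by rewrite lee_fin.
have colM i w : col i (M w) = x i w by apply/matrixP => k l; rewrite (ord1 l) !mxE.
have xsE w : xs w = mx_tuple (M w) by apply: eq_mktuple => i; rewrite colM.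
have xtE w : xt w = mx_tuple (chol (S2 w) *m (invmx (chol (S1 w)) *m M w)).
  by apply: eq_mktuple => i; rewrite mulmxA [in RHS]colE -[in RHS]mulmxA -colE colM.
have mM : measurable_fun setT M := measurable_sample hgauss.
have mS1 : measurable_fun setT S1 := measurable_gram hgauss (fun j => (j < d)%N).
have mS2 : measurable_fun setT S2 := measurable_gram hgauss (fun j => (d <= j)%N).
have mcS2 : measurable_fun setT (fun w => chol (S2 w)).
  exact: (measurableT_comp (@measurable_chol R d)).
have mxt : measurable_fun setT (fun w => chol (S2 w) *m (invmx (chol (S1 w)) *m M w)).
  apply: measurable_mulmx => //; apply: measurable_mulmx => //; apply: measurable_invmx.
  exact: (measurableT_comp (@measurable_chol R d)).
have PE : P (xt @^-1` A) = (\int[P]_w f (chol (S2 w) *m orth_factor (M w)))%E.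
  transitivity (\int[P]_w f (chol (S2 w) *m (invmx (chol (S1 w)) *m M w)))%E.
    rewrite -[in LHS](setIT (xt @^-1` A)) -integral_indic//.
      by apply: eq_integral => w _; rewrite /f -xtE.
    have mxt' : measurable_fun setT xt.
      rewrite (funext xtE); exact: (measurableT_comp (@measurable_mx_tuple R d)).
    by rewrite -[X in measurable X]setTI; exact: mxt'.
  (* The normalised first block is [orth_factor (M w)] where M is invertible; the singular outcomes
     form a null set. *)
  apply: ge0_ae_eq_integral => //.
  - exact: (measurableT_comp mf).
  - apply: (measurableT_comp mf); apply: measurable_mulmx => //.
    exact: (measurableT_comp (@measurable_orth_factor R d)).
  apply: filterS (sample_det_neq0 hSigma hgauss hindep) => w dw _.
  by rewrite /orth_factor (negbTE dw) -gram1E.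
have c0 : d`!%:R * \det Sigma != 0.
  rewrite mulf_neq0 ?pnatr_eq0 -?lt0n ?fact_gt0// -unitfE -unitmxE.
  exact: posdef_unitmx.
have := volume_sampling_law hSigma hgauss hindep mf f0; rewrite -PE => law.
rewrite /VS (_ : (\int[P]_w _)%E = ((d`!%:R * \det Sigma)%:E * P (xt @^-1` A))%E).
  by rewrite muleAC -EFinM divff// mul1e.
by rewrite law; apply: eq_integral => w _; rewrite xsE EFinM muleC.
Qed.
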